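(* Let $A=S_{\mathbf q}(V)$, let $K_\bullet$ be its Koszul resolution and $B_\bullet(A)$ its normalized bar resolution. Define $A$-bimodule maps $\Phi_p\colon K_p\to B_p(A)$ by $$\Phi_p(1\otimes(x_{j_1}\wedge\cdots\wedge x_{j_p})\otimes1)=\sum_{\pi\in\mathrm{Sym}_p}\mathrm{sgn}(\pi)\,q_\pi^{j_1,\dots,j_p}\otimes x_{j_{\pi(1)}}\otimes\cdots\otimes x_{j_{\pi(p)}}\otimes1\quad(1\le j_1<\cdots<j_p\le N),$$ and $A$-bimodule maps $\Psi_p\colon B_p(A)\to K_p$ by $\Psi_0=\mathrm{Id}$ and, for $p\ge1$ and $\underline{\ell}^1,\dots,\underline{\ell}^p\in\mathbb{N}^N$, $$\Psi_p(1\otimes\underline{x}^{\underline{\ell}^1}\otimes\cdots\otimes\underline{x}^{\underline{\ell}^p}\otimes1)=\sum_{1\le j_1<\cdots<j_p\le N}\ \sum_{\substack{0\le r_s\le\ell^s_{j_s}-1\\ s=1,\dots,p}}\mu\ \underline{x}^{\underline{Q}}\otimes(x_{j_1}\wedge\cdots\wedge x_{j_p})\otimes\underline{x}^{\widehat{\underline{Q}}},$$ where $\underline{Q}=\underline{Q}^{(\underline{\ell}^1,\dots,\underline{\ell}^p;j_1,\dots,j_p)}_{(r_1,\dots,r_p)}\in\mathbb{N}^N$ is given (with $j_0=0$, $j_{p+1}=N+1$) by $\underline{Q}_j=r_s+\ell^1_j+\cdots+\ell^{s-1}_j$ if $j=j_s$ ($1\le s\le p$) and $\underline{Q}_j=\ell^1_j+\cdots+\ell^s_j$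 if $j_s<j<j_{s+1}$ ($0\le s\le p$); $\widehat{\underline{Q}}=\underline{\ell}^1+\cdots+\underline{\ell}^p-\underline{Q}-\sum_{s=1}^pe_{j_s}\in\mathbb{N}^N$; and $\mu\in\mathbb{k}^\times$ is the unique scalar with $\mu\,\underline{x}^{\underline{Q}}x_{j_1}\cdots x_{j_p}\underline{x}^{\widehat{\underline{Q}}}=\underline{x}^{\underline{\ell}^1}\cdots\underline{x}^{\underline{\ell}^p}$ in $S_{\mathbf q}(V)$. Then (i) $\Phi_\bullet$ is a chain map from $K_\bullet$ to $B_\bullet(A)$ lifting the identity of $A$; (ii) $\Psi_\bullet$ is a chain map from $B_\bullet(A)$ to $K_\bullet$ lifting the identity of $A$; (iii) $\Psi_\bullet\circ\Phi_\bullet$ is the identity map of $K_\bullet$.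
   Context: $\mathbb{k}$ is a field, $\mathbf q=(q_{i,j})$ nonzero scalars with $q_{i,i}=1$, $q_{j,i}=q_{i,j}^{-1}$, and $S_{\mathbf q}(V)=\mathbb{k}\langle x_1,\dots,x_N\mid x_ix_j=q_{i,j}x_jx_i\rangle$, with $\mathbb{k}$-basis the ordered monomials $\underline{x}^{\underline{\ell}}=x_1^{\ell_1}\cdots x_N^{\ell_N}$. $e_u\in\mathbb{N}^N$ is the $u$-th standard basis vector. The Koszul resolution $K_\bullet$: $K_p=A\otimes\bigwedge^p(V)\otimes A$ with $A$-bimodule basis $1\otimes(x_{j_1}\wedge\cdots\wedge x_{j_p})\otimes1$ ($j_1<\cdots<j_p$), $d_0$ multiplication, and $d_p(1\otimes(x_{j_1}\wedge\cdots\wedge x_{j_p})\otimes1)=\sum_{i=1}^p(-1)^{i+1}(\prod_{s=1}^iq_{j_s,j_i})x_{j_i}\otimes(x_{j_1}\wedge\cdots\widehat{x_{j_i}}\cdots\wedge x_{j_p})\otimes1-\sum_{i=1}^p(-1)^{i+1}(\prod_{s=i}^pq_{j_i,j_s})1\otimes(x_{j_1}\wedge\cdots\widehat{x_{j_i}}\cdots\wedge x_{j_p})\otimes x_{j_i}$. The normalized bar resolution: $\overline{A}=A/\mathbb{k}1$, $B_p(A)=A\otimes\overline{A}^{\otimes p}\otimes A$, with $\delta_p(a_0\otimes a_1\otimes\cdots\otimes a_p\otimes a_{p+1})=\sum_{i=0}^p(-1)^ia_0\otimes\cdots\otimes a_ia_{i+1}\otimes\cdots\otimes a_{p+1}$ (elements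 of $\overline A$ written by representatives). For $\pi\in\mathrm{Sym}_p$, the scalar $q_\pi^{j_1,\dots,j_p}$ is defined by $q_\pi^{j_1,\dots,j_p}x_{j_{\pi(1)}}\cdots x_{j_{\pi(p)}}=x_{j_1}\cdots x_{j_p}$ in $S_{\mathbf q}(V)$. (If some $\underline{\ell}^s=0$ the inner sum defining $\Psi_p$ is empty, so $\Psi_p$ is well defined on $\overline A$.) *)

(* Defs.v *)
From HB Require Import structures.
From mathcomp Require Import all_boot all_order fingroup perm all_algebra.
Set Implicit Arguments. Unset Strict Implicit. Unset Printing Implicit Defensive.
Import GRing.Theory.
Local Open Scope ring_scope.

(** * Quantum polynomial algebra S_q(V), modelled on its PBW k-basis.
    A monomial x^l = x_1^{l_1} ... x_N^{l_N} is represented by its exponent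
    vector l : 'I_N -> nat.  The product of basis monomials in S_q(V) is
    x^a x^b = (prod_{i>j} q_{i,j}^{a_i b_j}) x^{a+b}. *)

Definition mono (N : nat) := {ffun 'I_N -> nat}.
Definition mono0 (N : nat) : mono N := [ffun => 0%N].
Definition addm (N : nat) (a b : mono N) : mono N := [ffun i => (a i + b i)%N].
Definition ev (N : nat) (j : 'I_N) : mono N := [ffun i => nat_of_bool (i == j)].

(* the twisting scalar: x^a x^b = tw q a b x^(a+b) *)
Definition tw (k : fieldType) (N : nat) (q : 'I_N -> 'I_N -> k) (a b : mono N) : k :=
  \prod_(i < N) \prod_(j < N | (j < i)%N) q i j ^+ (a i * b j).

(* product x^(m_1) x^(m_2) ... x^(m_r) = c x^m, returned as (c, m) *)
Definition mprod (k : fieldType) (N : nat) (q : 'I_N -> 'I_N -> k) (ms : seq (mono N))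
  : k * mono N :=
  foldl (fun cm n => (cm.1 * tw q cm.2 n, addm cm.2 n)) (1, mono0 N) ms.

Definition vec (k : fieldType) (T : Type) := seq (k * T).
Definition coef (k : fieldType) (T : eqType) (v : vec k T) (t : T) : k :=
  \sum_(x <- v | x.2 == t) x.1.
Definition veq (k : fieldType) (T : eqType) (v w : vec k T) : Prop :=
  forall t, coef v t = coef w t.
Definition scalev (k : fieldType) (T : Type) (c : k) (v : vec k T) : vec k T :=
  [seq (c * x.1, x.2) | x <- v].
Definition linext (k : fieldType) (T U : Type) (f : T -> vec k U) (v : vec k T) : vec k U :=
  flatten [seq scalev x.1 (f x.2) | x <- v].

(** * k-bases of the modules.
    K_p = A (x) Lambda^p V (x) A : basis (x^a, J, x^b), J a p-subset of 'I_N,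
      standing for x^a (x) (x_{j_1} /\ ... /\ x_{j_p}) (x) x^b with j_1<...<j_p
      the increasing enumeration of J.
    B_p = A (x) Abar^{(x)p} (x) A : basis (x^a, [x^{l^1};...;x^{l^p}], x^b)
      with all l^s nonzero; a representative with some l^s = 0 is 0 in B_p. *)
Definition Kb (N : nat) := (mono N * {set 'I_N} * mono N)%type.
Definition Bb (N : nat) := (mono N * seq (mono N) * mono N)%type.

Definition validB (N : nat) (t : Bb N) : bool := all (fun m => m != mono0 N) t.1.2.
(* equality in the normalized bar module (quotient by the span of the
   representatives having some middle tensor factor equal to 1) *)
Definition veqB (k : fieldType) (N : nat) (v w : vec k (Bb N)) : Prop :=
  forall t, validB t -> coef v t = coef w t.

Definition extK (k : fieldType) (N : nat) (q : 'I_N -> 'I_N -> k) (a b : mono N)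
  (v : vec k (Kb N)) : vec k (Kb N) :=
  [seq (x.1 * tw q a x.2.1.1 * tw q x.2.2 b, (addm a x.2.1.1, x.2.1.2, addm x.2.2 b)) | x <- v].
Definition extB (k : fieldType) (N : nat) (q : 'I_N -> 'I_N -> k) (a b : mono N)
  (v : vec k (Bb N)) : vec k (Bb N) :=
  [seq (x.1 * tw q a x.2.1.1 * tw q x.2.2 b, (addm a x.2.1.1, x.2.1.2, addm x.2.2 b)) | x <- v].

Definition mulA (k : fieldType) (N : nat) (q : 'I_N -> 'I_N -> k) (a b : mono N)
  : vec k (mono N) := [:: (tw q a b, addm a b)].
Definition epsK (k : fieldType) (N : nat) (q : 'I_N -> 'I_N -> k) (t : Kb N) :=
  mulA q t.1.1 t.2.
Definition epsB (k : fieldType) (N : nat) (q : 'I_N -> 'I_N -> k) (t : Bb N) :=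
  mulA q t.1.1 t.2.

Definition dKgen (k : fieldType) (N : nat) (q : 'I_N -> 'I_N -> k) (J : {set 'I_N})
  : vec k (Kb N) :=
  let js := in_tuple (enum J) in
  [seq ((-1) ^+ i * \prod_(s < size (enum J) | (s <= i)%N) q (tnth js s) (tnth js i),
        (ev (tnth js i), J :\ tnth js i, mono0 N)) | i : 'I_(size (enum J)) <- enum 'I_(size (enum J))]
  ++
  [seq (- ((-1) ^+ i * \prod_(s < size (enum J) | (i <= s)%N) q (tnth js i) (tnth js s)),
        (mono0 N, J :\ tnth js i, ev (tnth js i))) | i : 'I_(size (enum J)) <- enum 'I_(size (enum J))].
Definition dK (k : fieldType) (N : nat) (q : 'I_N -> 'I_N -> k) (t : Kb N) : vec k (Kb N) :=
  extK q t.1.1 t.2 (dKgen q t.1.2).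

Definition ofL (N : nat) (L : seq (mono N)) : Bb N :=
  (head (mono0 N) L, take (size L - 2) (behead L), last (mono0 N) L).
Definition barD (k : fieldType) (N : nat) (q : 'I_N -> 'I_N -> k) (t : Bb N) : vec k (Bb N) :=
  let L := t.1.1 :: t.1.2 ++ [:: t.2] in
  [seq ((-1) ^+ i * tw q (nth (mono0 N) L i) (nth (mono0 N) L i.+1),
        ofL (take i L ++ addm (nth (mono0 N) L i) (nth (mono0 N) L i.+1) :: drop i.+2 L))
  | i <- iota 0 (size t.1.2).+1].

(* q_pi^{j_1..j_p} : q_pi x_{j_pi(1)} ... x_{j_pi(p)} = x_{j_1} ... x_{j_p} *)
Definition qpi (k : fieldType) (N : nat) (q : 'I_N -> 'I_N -> k) (n : nat)
  (js : n.-tuple 'I_N) (pi : 'S_n) : k :=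
  (mprod q (map (@ev N) js)).1 /
  (mprod q [seq ev (tnth js (pi i)) | i <- enum 'I_n]).1.

Definition PhiGen (k : fieldType) (N : nat) (q : 'I_N -> 'I_N -> k) (J : {set 'I_N})
  : vec k (Bb N) :=
  let js := in_tuple (enum J) in
  [seq ((-1) ^+ odd_perm pi * qpi q js pi,
        (mono0 N, [seq ev (tnth js (pi i)) | i : 'I_(size (enum J)) <- enum 'I_(size (enum J))], mono0 N))
  | pi : 'S_(size (enum J)) <- enum [set: 'S_(size (enum J))]].
Definition Phi (k : fieldType) (N : nat) (q : 'I_N -> 'I_N -> k) (t : Kb N) : vec k (Bb N) :=
  extB q t.1.1 t.2 (PhiGen q t.1.2).

Definition rtuples (bs : seq nat) : seq (seq nat) :=
  foldr (fun b acc => [seq x :: t | x <- iota 0 b, t <- acc]) [:: [::]] bs.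

(* ls = [l^1; ...; l^p], J = {j_1 < ... < j_p}, r = [r_1; ...; r_p].
   For j in 'I_N let s(j) = #{j' in J | j' < j}; then j = j_{s(j)+1} if j \in J,
   and j_{s(j)} < j < j_{s(j)+1} otherwise.  (0-indexed lists below.) *)
Definition sJ (N : nat) (J : {set 'I_N}) (j : 'I_N) : nat := #|[set i in J | (i < j)%N]|.
Definition Qv (N : nat) (ls : seq (mono N)) (J : {set 'I_N}) (r : seq nat) : mono N :=
  [ffun j => ((if j \in J then nth 0%N r (sJ J j) else 0%N)
              + \sum_(t < sJ J j) (nth (mono0 N) ls t) j)%N].
Definition Qhat (N : nat) (ls : seq (mono N)) (J : {set 'I_N}) (r : seq nat) : mono N :=
  [ffun j => (\sum_(t < size ls) (nth (mono0 N) ls t) j - Qv ls J r j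
              - nat_of_bool (j \in J))%N].
(* mu x^Q x_{j_1} ... x_{j_p} x^Qhat = x^{l^1} ... x^{l^p} *)
Definition mu (k : fieldType) (N : nat) (q : 'I_N -> 'I_N -> k) (ls : seq (mono N))
  (J : {set 'I_N}) (r : seq nat) : k :=
  (mprod q ls).1 /
  (mprod q (Qv ls J r :: map (@ev N) (enum J) ++ [:: Qhat ls J r])).1.

Definition PsiGen (k : fieldType) (N : nat) (q : 'I_N -> 'I_N -> k) (ls : seq (mono N))
  : vec k (Kb N) :=
  if ls is [::] then [:: (1, (mono0 N, set0, mono0 N))] else
  flatten [seq [seq (mu q ls J r, (Qv ls J r, J, Qhat ls J r))
               | r <- rtuples [seq (x.1 : mono N) x.2 | x : mono N * 'I_N <- zip ls (enum J)]]
          | J : {set 'I_N} <- filter (fun J0 : {set 'I_N} => #|J0| == size ls) (enum {: {set 'I_N}})].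
Definition Psi (k : fieldType) (N : nat) (q : 'I_N -> 'I_N -> k) (t : Bb N) : vec k (Kb N) :=
  extK q t.1.1 t.2 (PsiGen q t.1.2).

(* Main.v *)
Require Import Defs.
From HB Require Import structures.
From mathcomp Require Import all_boot all_order fingroup perm all_algebra.
From mathcomp Require Import ring zify.
From mathcomp Require mpoly.
Set Implicit Arguments. Unset Strict Implicit. Unset Printing Implicit Defensive.
Import GRing.Theory.
Local Open Scope ring_scope.

(** Divide each basis vector (x^a, w, x^b) of K_p or B_p by the scalar c defined by
    "product in S_q(V) of all the entries = c x^total".  In the rescaled bases every
    map of the theorem loses its q-coefficients, so everything reduces to the
    commutative polynomial ring, q = 1.

    There, read A (x) A as k[x, y].  The J-component of Psi_p(f_1, ..., f_p), for
    J = {j_1 < ... < j_p}, is the product of the divided differences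
    d_{j_s} f_s = (D_{j_s} f_s - D_{j_s + 1} f_s) / (x_{j_s} - y_{j_s}), where
    D_j f = f(y_1, ..., y_{j-1}, x_j, ..., x_N).  The Leibniz rule
    d_j (f g) = d_j f * D_{j+1} g + D_j f * d_j g handles the inner faces of the bar
    differential, and in the Koszul differential the terms adding an index between
    j_s and j_{s+1} telescope to differences D - D; the two sums then agree.
    For Phi, the inner faces cancel in pairs and the outer ones are an expansion of
    Sym_{p+1} along the image of the first or last index.  Finally
    d_j (x_i) is 1 if i = j and 0 otherwise, so only the identity permutation
    contributes to Psi o Phi. *)

(** * The twisting scalar of a product *)

Section Monomials.
Variable N : nat.
Implicit Types (a b c : mono N) (ls : seq (mono N)) (J : {set 'I_N}).

Lemma addmA : associative (@addm N).
Proof. by move=> a b c; apply/ffunP => i; rewrite !ffunE addnA. Qed.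

Lemma addmC : commutative (@addm N).
Proof. by move=> a b; apply/ffunP => i; rewrite !ffunE addnC. Qed.

Lemma add0m : left_id (mono0 N) (@addm N).
Proof. by move=> a; apply/ffunP => i; rewrite !ffunE. Qed.

Lemma addm0 : right_id (mono0 N) (@addm N).
Proof. by move=> a; rewrite addmC add0m. Qed.

End Monomials.

HB.instance Definition _ (N : nat) :=
  Monoid.isComLaw.Build (mono N) (mono0 N) (@addm N) (@addmA N) (@addmC N) (@add0m N).

Section Twist.
Variables (k : fieldType) (N : nat) (q : 'I_N -> 'I_N -> k).
Hypothesis hq0 : forall i j, q i j != 0.
Implicit Types (a b c : mono N) (ls s t : seq (mono N)) (J : {set 'I_N}).

Definition totalm ls : mono N := \big[@addm N/mono0 N]_(m <- ls) m.

Lemma tw0m a : tw q (mono0 N) a = 1.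
Proof. by rewrite /tw big1 // => i _; rewrite big1 // => j _; rewrite ffunE mul0n. Qed.

Lemma twm0 a : tw q a (mono0 N) = 1.
Proof. by rewrite /tw big1 // => i _; rewrite big1 // => j _; rewrite ffunE muln0. Qed.

(** With [twDr], the twist is a bicharacter on exponent vectors. Hence the scalar of a product
    depends on a block of factors only through the total exponent of that block and its own internal
    scalar. *)
Lemma twDl a b c : tw q (addm a b) c = tw q a c * tw q b c.
Proof.
rewrite /tw -big_split; apply: eq_bigr => i _; rewrite -big_split.
by apply: eq_bigr => j _; rewrite ffunE mulnDl exprD.
Qed.

Lemma twDr a b c : tw q a (addm b c) = tw q a b * tw q a c.
Proof.
rewrite /tw -big_split; apply: eq_bigr => i _; rewrite -big_split.
by apply: eq_bigr => j _; rewrite ffunE mulnDr exprD.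
Qed.

Lemma tw_neq0 a b : tw q a b != 0.
Proof. by apply/prodf_neq0 => i _; apply/prodf_neq0 => j _; rewrite expf_neq0. Qed.

Lemma tw_ev i j : tw q (ev i) (ev j) = if (j < i)%N then q i j else 1.
Proof.
rewrite /tw (bigD1 i) //= [X in _ * X]big1 ?mulr1; last first.
  by move=> l /negPf nli; rewrite big1 // => m _; rewrite !ffunE nli.
rewrite big_mkcond (bigD1 j) //= big1 ?mulr1 ?ffunE ?eqxx //.
by move=> l /negPf nlj; rewrite !ffunE nlj muln0; case: ifP.
Qed.

Lemma tw_totalm_l ls a : tw q (totalm ls) a = \prod_(m <- ls) tw q m a.
Proof.
by apply: (big_morph (fun m => tw q m a)) => [m n|]; rewrite ?twDl ?tw0m.
Qed.

Lemma tw_totalm_r a ls : tw q a (totalm ls) = \prod_(m <- ls) tw q a m.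
Proof. by apply: (big_morph (tw q a)) => [m n|]; rewrite ?twDr ?twm0. Qed.

Definition mscal ls : k := (mprod q ls).1.

Lemma mprod_rcons ls a :
  mprod q (rcons ls a) = (mscal ls * tw q (mprod q ls).2 a, addm (mprod q ls).2 a).
Proof. by rewrite /mprod foldl_rcons. Qed.

Lemma mprod2 ls : (mprod q ls).2 = totalm ls.
Proof.
elim/last_ind: ls => [|ls a IH]; first by rewrite /totalm big_nil.
by rewrite mprod_rcons /= IH /totalm -cats1 big_cat big_seq1.
Qed.

Lemma mscal_nil : mscal [::] = 1.
Proof. by rewrite /mscal. Qed.

Lemma mscal_rcons ls a : mscal (rcons ls a) = mscal ls * tw q (totalm ls) a.
Proof. by rewrite {1}/mscal mprod_rcons mprod2. Qed.

Lemma totalm_cat s t : totalm (s ++ t) = addm (totalm s) (totalm t).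
Proof. by rewrite /totalm big_cat. Qed.

Lemma totalm_cons a s : totalm (a :: s) = addm a (totalm s).
Proof. by rewrite /totalm big_cons. Qed.

Lemma totalm_nil : totalm [::] = mono0 N.
Proof. by rewrite /totalm big_nil. Qed.

(** Associativity of S_q(V) in coordinates: order each block first, then multiply the two resulting
    monomials. *)
Lemma mscal_cat s t : mscal (s ++ t) = mscal s * mscal t * tw q (totalm s) (totalm t).
Proof.
elim/last_ind: t => [|t a IH]; first by rewrite cats0 totalm_nil twm0 !mulr1.
rewrite -rcons_cat !mscal_rcons IH -cats1 !totalm_cat totalm_cons totalm_nil addm0.
rewrite twDl twDr; ring.
Qed.

Lemma mscal1 a : mscal [:: a] = 1.
Proof. by rewrite (mscal_rcons [::]) totalm_nil tw0m mulr1. Qed.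

Lemma mscal_cons a s : mscal (a :: s) = mscal s * tw q a (totalm s).
Proof. by rewrite -cat1s mscal_cat mscal1 mul1r totalm_cons totalm_nil addm0. Qed.

Lemma mscal_neq0 ls : mscal ls != 0.
Proof. by elim: ls => [|a s IH]; rewrite ?mscal_nil ?oner_neq0 // mscal_cons mulf_neq0 ?tw_neq0. Qed.

(* Both sides compute the scalar of the product a * s * b; this is what makes a
   map that is homogeneous on bimodule generators homogeneous everywhere. *)
Lemma mscal_ext a b s u1 cs u3 : totalm s = totalm (u1 :: cs ++ [:: u3]) ->
  mscal (a :: s ++ [:: b]) / mscal (addm a u1 :: cs ++ [:: addm u3 b]) =
  mscal s / mscal (u1 :: cs ++ [:: u3]) * tw q a u1 * tw q u3 b.
Proof.
move=> Es; rewrite !(mscal_cons, mscal_cat, mscal_nil).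
rewrite !(totalm_cat, totalm_cons, totalm_nil, addm0) Es.
rewrite !(totalm_cat, totalm_cons, totalm_nil, addm0) !(twDl, twDr, twm0).
by field; rewrite !(tw_neq0, mscal_neq0).
Qed.

Lemma mscal_core s : mscal (mono0 N :: s ++ [:: mono0 N]) = mscal s.
Proof.
by rewrite mscal_cons tw0m mulr1 mscal_cat mscal1 totalm_cons totalm_nil addm0 twm0 !mulr1.
Qed.

Lemma totalm_core s : totalm (mono0 N :: s ++ [:: mono0 N]) = totalm s.
Proof. by rewrite totalm_cons add0m totalm_cat totalm_cons totalm_nil !addm0. Qed.

(** The rescaling constants. In [weightK] the wedge is read as the product x_{j_1} ... x_{j_p} in
    increasing order, the reading that also normalizes [mu] and [qpi]. *)
Definition weightB (t : Bb N) : k := mscal (t.1.1 :: t.1.2 ++ [:: t.2]).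
Definition weightK (t : Kb N) : k :=
  mscal (t.1.1 :: map (@ev N) (enum t.1.2) ++ [:: t.2]).

Lemma weightB_neq0 u : weightB u != 0. Proof. exact: mscal_neq0. Qed.
Lemma weightK_neq0 u : weightK u != 0. Proof. exact: mscal_neq0. Qed.

End Twist.

(** * The untwisted case, where every scalar is 1 *)

Section Untwisted.
Variables (k : fieldType) (N : nat).
Definition q1 (i j : 'I_N) : k := 1.

Lemma tw_q1 a b : tw q1 a b = 1.
Proof. by rewrite /tw big1 // => i _; rewrite big1 // => j _; rewrite expr1n. Qed.

Lemma mscal_q1 ls : mscal q1 ls = 1.
Proof. by elim: ls => [|a s IH]; rewrite ?mscal_nil // mscal_cons tw_q1 IH mulr1. Qed.

Lemma mprod_q1 ls : (mprod q1 ls).1 = 1. Proof. exact: mscal_q1. Qed.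
End Untwisted.

(* The vector v' with source weight c written in the basis rescaled by w. *)
Definition regrade (k : fieldType) (T : Type) (c : k) (w : T -> k) (v' : vec k T) : vec k T :=
  [seq (c / w x.2 * x.1, x.2) | x <- v'].

Section Regrade.
Variable k : fieldType.

(** The intermediate weight [w] cancels, so rescaled maps compose. The condition on [g] is imposed
    only on the entries of [v'] because the rescaling identities for [barD] and [epsB] are available
    only in certain degrees. *)
Lemma linext_regrade (T U : eqType) (c : k) (w : T -> k) (w' : U -> k)
    (g g' : T -> vec k U) (v' : vec k T) :
  (forall t, w t != 0) -> (forall x, x \in v' -> g x.2 = regrade (w x.2) w' (g' x.2)) ->
  linext g (regrade c w v') = regrade c w' (linext g' v').
Proof.
move=> w0 gE; rewrite /linext /regrade map_flatten -!map_comp; congr flatten.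
apply/eq_in_map => x xv /=; rewrite gE // /scalev /regrade -!map_comp.
apply: eq_map => y /=; congr pair.
transitivity (c * x.1 * y.1 / w' y.2 * ((w x.2)^-1 * w x.2)); first by ring.
by rewrite mulVf // mulr1; ring.
Qed.

Lemma coef_regrade (T : eqType) (c : k) (w : T -> k) v' t :
  coef (regrade c w v') t = c / w t * coef v' t.
Proof.
rewrite /coef big_map big_distrr /=.
by apply: eq_bigr => x /eqP ->.
Qed.

Lemma veq_regrade (T : eqType) (c : k) (w : T -> k) v v' :
  veq v v' -> veq (regrade c w v) (regrade c w v').
Proof. by move=> E t; rewrite !coef_regrade E. Qed.

End Regrade.

(** * Removing the twist *)

Section Ordinals.
Variable N : nat.
Implicit Types (J : {set 'I_N}) (i j : 'I_N) (s : seq 'I_N).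

Lemma sorted_enum_set J : sorted (fun i j : 'I_N => (i < j)%N) (enum J).
Proof.
have tr : transitive (fun i j : 'I_N => (i < j)%N) by move=> a b c; exact: ltn_trans.
rewrite {1}/enum_mem -enumT; apply: sorted_filter => //.
by have := iota_ltn_sorted 0 N; rewrite -val_enum_ord sorted_map.
Qed.

Lemma enum_setD1 J j : enum (J :\ j) = [seq i <- enum J | i != j].
Proof.
rewrite {1 2}/enum_mem -filter_predI; apply: eq_filter => i /=.
by have := in_setD1 i J j.
Qed.

Lemma enum_setD1_cat J j s1 s2 : enum J = s1 ++ j :: s2 -> enum (J :\ j) = s1 ++ s2.
Proof.
move=> E; have := enum_uniq J; rewrite enum_setD1 E cat_uniq /= negb_or.
case/and3P => _ /andP[js1 _] /andP[js2 _].
rewrite filter_cat /= eqxx; congr cat; apply/all_filterP/allP => i ii.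
  by apply: contraNneq js1 => <-.
by apply: contraNneq js2 => <-.
Qed.

Lemma enum_split_tnth J (i : 'I_(size (enum J))) :
  enum J = take i (enum J) ++ tnth (in_tuple (enum J)) i :: drop i.+1 (enum J).
Proof.
by rewrite (tnth_nth (tnth (in_tuple (enum J)) i)) /= -drop_nth ?cat_take_drop.
Qed.

Lemma prod_tnth_take (R : comNzRingType) (l : seq 'I_N) (m : nat) (F : 'I_N -> R) :
  (m <= size l)%N ->
  \prod_(s < size l | (s < m)%N) F (tnth (in_tuple l) s) = \prod_(j <- take m l) F j.
Proof.
case: l => [|x l] ml; first by rewrite big_ord0 big_nil.
rewrite [RHS](big_nth x) size_takel // big_mkord.
rewrite (big_ord_widen _ (fun i : nat => F (nth x (take m (x :: l)) i)) ml).
by apply: eq_bigr => i im; rewrite (tnth_nth x) nth_take.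
Qed.

Lemma prod_tnth_drop (R : comNzRingType) (l : seq 'I_N) (m : nat) (F : 'I_N -> R) :
  (m <= size l)%N ->
  \prod_(s < size l | (m <= s)%N) F (tnth (in_tuple l) s) = \prod_(j <- drop m l) F j.
Proof.
case: l => [|x l] ml; first by rewrite big_ord0 big_nil.
transitivity (\prod_(m <= i < size (x :: l)) F (nth x (x :: l) i)).
  by rewrite big_geq_mkord; apply: eq_bigr => i _; rewrite (tnth_nth x).
rewrite [RHS](big_nth x) size_drop -{1}[m]add0n big_addn.
by apply: eq_bigr => i _; rewrite nth_drop addnC.
Qed.

Lemma sJE J j : sJ J j = count (fun i => (i < j)%N) (enum J).
Proof.
rewrite /sJ -sum1_card -sum1_count big_enum_cond /=.
by apply: eq_bigl => i; rewrite inE.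
Qed.

(** In an increasing list the entries below [i] form an initial segment, whose length is their
    number. *)
Lemma sorted_count_lt (s : seq 'I_N) j0 (i : 'I_N) t :
  sorted (fun i j : 'I_N => (i < j)%N) s -> (t < size s)%N ->
  (nth j0 s t < i)%N = (t < count (fun j => j < i)%N s)%N.
Proof.
have tr : transitive (fun i j : 'I_N => (i < j)%N) by move=> a b c; exact: ltn_trans.
elim: s t => // x s IH t; rewrite /= (path_sortedE tr) => /andP[/allP xs sort_s].
have cnt0 : (i <= x)%N -> count (fun j => j < i)%N s = 0%N.
  move=> ix; apply/eqP; rewrite -leqn0 leqNgt -has_count; apply/hasPn => y ys.
  by rewrite -leqNgt (leq_trans ix) // ltnW // xs.
case: t => [_|t ts] /=; first by case: (ltnP x i) => // /cnt0 ->.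
rewrite IH //; case: (ltnP x i) => // /cnt0 ->; by rewrite ltn0.
Qed.

Lemma nth_enum_set_lt J j0 (i : 'I_N) t : (t < #|J|)%N ->
  (nth j0 (enum J) t < i)%N = (t < sJ J i)%N.
Proof. by rewrite cardE sJE => tJ; apply: sorted_count_lt (sorted_enum_set J) tJ. Qed.

Lemma sJ_nth J j0 t : (t < #|J|)%N -> sJ J (nth j0 (enum J) t) = t.
Proof.
move=> tJ; apply/eqP; rewrite eqn_leq leqNgt -(nth_enum_set_lt j0) // ltnn /=.
rewrite leqNgt; apply/negP => st.
have := nth_enum_set_lt j0 (nth j0 (enum J) t) (ltn_trans st tJ); rewrite ltnn.
have tr : transitive (fun i j : 'I_N => (i < j)%N) by move=> a b c; exact: ltn_trans.
by rewrite (sorted_ltn_nth tr j0 (sorted_enum_set J)) ?inE -?cardE // (ltn_trans st tJ).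
Qed.

Lemma sJ_index J j : j \in J -> sJ J j = index j (enum J).
Proof.
rewrite -mem_enum => jJ; rewrite -{1}(nth_index j jJ) sJ_nth //.
by rewrite cardE index_mem.
Qed.

End Ordinals.

(** * The four families of maps in the rescaled bases *)

Section Regrading.
Variables (k : fieldType) (N : nat) (q : 'I_N -> 'I_N -> k).
Hypothesis (hq0 : forall i j, q i j != 0) (hq1 : forall i, q i i = 1).
Hypothesis hqinv : forall i j, q j i = (q i j)^-1.
Implicit Types (a b c : mono N) (ls : seq (mono N)) (J : {set 'I_N}).
Local Notation q1 := (@q1 k N).

(** The scalar [qpi] is a ratio of scalars of two words with the same total exponent, since [pi]
    only permutes the letters; this is the ratio of the weights, and [mscal_ext] carries it to
    arbitrary outer factors. *)
Lemma Phi_regrade u : Phi q u = regrade (weightK q u) (weightB q) (Phi q1 u).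
Proof.
case: u => [[a J] b]; rewrite /Phi /extB /PhiGen /regrade -!map_comp.
apply: eq_map => pi /=; rewrite !tw_q1 /qpi !mprod_q1 /weightK /weightB /=.
congr pair; rewrite (mscal_ext hq0); last first.
  rewrite !totalm_core /totalm !big_map -[X in \big[_/_]_(j <- X) _]/(tval (in_tuple (enum J))).
  by rewrite big_tuple (reindex_inj (@perm_inj _ pi)).
rewrite !mscal_core !twm0 !tw0m !(mulr1, divr1).
by rewrite /mscal mulrC.
Qed.

(** The defining relation x_i x_j = q_{i,j} x_j x_i, recovered from the twist on ordered monomials
    by means of the two conditions on q. *)
Lemma tw_skew i j : tw q (ev i) (ev j) / tw q (ev j) (ev i) = q i j.
Proof.
rewrite !tw_ev; case: ltngtP => [ij|ij|/val_inj ->]; by rewrite ?divr1 ?div1r ?hq1.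
Qed.

Lemma prod_tw_skew_l j (s : seq 'I_N) :
  tw q (totalm (map (@ev N) s)) (ev j) / tw q (ev j) (totalm (map (@ev N) s)) =
  \prod_(i <- s) q i j.
Proof.
rewrite tw_totalm_l tw_totalm_r !big_map -prodf_div.
by apply: eq_bigr => i _; rewrite tw_skew.
Qed.

Lemma prod_tw_skew_r j (s : seq 'I_N) :
  tw q (ev j) (totalm (map (@ev N) s)) / tw q (totalm (map (@ev N) s)) (ev j) =
  \prod_(i <- s) q j i.
Proof.
rewrite tw_totalm_l tw_totalm_r !big_map -prodf_div.
by apply: eq_bigr => i _; rewrite tw_skew.
Qed.

(** Pulling x_j out of the wedge to the left moves it past the letters of [s1], each giving a factor
    q_{i,j}. The remaining factors are the twists inserted by [extK]. The next lemma is the mirror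
    image. *)
Lemma weightK_setD1_l J j (s1 s2 : seq 'I_N) a b : enum J = s1 ++ j :: s2 ->
  weightK q (a, J, b) / weightK q (addm a (ev j), J :\ j, addm (mono0 N) b) =
  (\prod_(i <- s1) q i j) * tw q a (ev j) * tw q (mono0 N) b.
Proof.
move=> E; rewrite /weightK /= (enum_setD1_cat E) E (mscal_ext hq0); last first.
  rewrite !map_cat /= !(totalm_cons, totalm_cat, totalm_nil, addm0).
  by rewrite addmA [RHS]addmA; congr addm; apply: addmC.
congr (_ * _ * _); rewrite -prod_tw_skew_l !map_cat /= !(mscal_cons, mscal_cat, mscal_nil).
rewrite !(totalm_cons, totalm_cat, totalm_nil, addm0) !(twDl, twDr, twm0).
by field; rewrite !(tw_neq0, mscal_neq0).
Qed.

Lemma weightK_setD1_r J j (s1 s2 : seq 'I_N) a b : enum J = s1 ++ j :: s2 ->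
  weightK q (a, J, b) / weightK q (addm a (mono0 N), J :\ j, addm (ev j) b) =
  (\prod_(i <- s2) q j i) * tw q a (mono0 N) * tw q (ev j) b.
Proof.
move=> E; rewrite /weightK /= (enum_setD1_cat E) E (mscal_ext hq0); last first.
  rewrite !map_cat /= !(totalm_cons, totalm_cat, totalm_nil, addm0) add0m.
  by rewrite -[RHS]addmA; congr addm; apply: addmC.
congr (_ * _ * _); rewrite -prod_tw_skew_r !map_cat /= !(mscal_cons, mscal_cat, mscal_nil).
rewrite !(totalm_cons, totalm_cat, totalm_nil, addm0) !(twDl, twDr, twm0, tw0m).
by field; rewrite !(tw_neq0, mscal_neq0).
Qed.

Lemma prod_q1 (I : Type) (r : seq I) (P : pred I) (F G : I -> 'I_N) :
  \prod_(i <- r | P i) q1 (F i) (G i) = 1.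
Proof. by rewrite big1. Qed.

Lemma dK_regrade u : dK q u = regrade (weightK q u) (weightK q) (dK q1 u).
Proof.
case: u => [[a J] b]; rewrite /dK /extK /dKgen /regrade !map_cat -!map_comp.
congr cat; apply: eq_map => i /=; rewrite !tw_q1 prod_q1 !mulr1; congr pair.
  rewrite (weightK_setD1_l _ _ (enum_split_tnth i)).
  (* The product in the differential runs over s <= i, one factor more than the letters passed; the
     extra factor is q_{j_i,j_i} = 1. *)
  have -> := @prod_tnth_take _ _ (enum J) i.+1 (q^~ (tnth (in_tuple (enum J)) i)) (ltn_ord i).
  have j0 := tnth (in_tuple (enum J)) i.
  rewrite (take_nth j0) // -cats1 big_cat big_seq1 (tnth_nth j0) /= hq1; ring.
rewrite (weightK_setD1_r _ _ (enum_split_tnth i)).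
have -> := @prod_tnth_drop _ _ (enum J) i (q (tnth (in_tuple (enum J)) i)) (ltnW (ltn_ord i)).
have j0 := tnth (in_tuple (enum J)) i.
rewrite (drop_nth j0 (ltn_ord i : (i < size (enum J))%N)) big_cons (tnth_nth j0) /= hq1; ring.
Qed.

Lemma totalm_nth ls j : totalm ls j = \sum_(t < size ls) nth (mono0 N) ls t j.
Proof.
rewrite /totalm -(big_mkord predT (fun t => nth (mono0 N) ls t j)) -(big_nth _ predT (fun m : mono N => m j)).
by apply: (big_morph (fun m : mono N => m j)) => [m n|]; rewrite ffunE.
Qed.

Lemma mem_rtuples bs r : r \in rtuples bs ->
  size r = size bs /\ forall t, (t < size bs)%N -> (nth 0%N r t < nth 0%N bs t)%N.
Proof.
elim: bs r => [|b bs IH] r /=; first by rewrite inE => /eqP ->.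
case/allpairsP => -[x s] /= [xb sbs ->]; have [szs lts] := IH _ sbs; split => /=.
  by rewrite szs.
by case=> [|t] //= tb; [move: xb; rewrite mem_iota | apply: lts].
Qed.

Lemma totalm_evs J j : totalm (map (@ev N) (enum J)) j = (j \in J).
Proof.
transitivity (\sum_(i <- enum J) ev i j)%N.
  rewrite /totalm big_map.
  by apply: (big_morph (fun m : mono N => m j)) => [m n|]; rewrite ffunE.
under eq_bigr do rewrite ffunE.
rewrite -mem_enum -(count_uniq_mem _ (enum_uniq J)) -sum1_count [RHS]big_mkcond.
by apply: eq_bigr => i _; rewrite eq_sym /=; case: eqP.
Qed.

(** [Qhat] is a truncated difference. The bound r_s < l^s_{j_s} leaves room in each coordinate of J
    for both Q and the unit taken by the wedge, so nothing is cut off. *)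
Lemma Psi_totalm ls J r : #|J| = size ls ->
  r \in rtuples [seq (x.1 : mono N) x.2 | x : mono N * 'I_N <- zip ls (enum J)] ->
  totalm ls = totalm (Qv ls J r :: map (@ev N) (enum J) ++ [:: Qhat ls J r]).
Proof.
move=> szJ /mem_rtuples []; rewrite size_map size_zip -cardE szJ minnn => szr ltr.
apply/ffunP => j; rewrite totalm_cons totalm_cat totalm_cons totalm_nil addm0.
rewrite totalm_nth /addm !ffunE totalm_evs addnA -subnDA subnKC //.
rewrite -(big_mkord predT (fun t => nth (mono0 N) ls t j)) -(big_mkord predT (fun t => nth (mono0 N) ls t j)).
case: ifP => jJ; last first.
  rewrite add0n addn0 (@big_cat_nat _ _ _ (sJ J j) 0 (size ls)) ?leq_addr //=.
  by rewrite sJE -szJ cardE count_size.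
have sJlt : (sJ J j < size ls)%N.
  by rewrite -szJ sJ_index // cardE index_mem mem_enum.
rewrite addn1 (@big_cat_nat _ _ _ (sJ J j) 0 (size ls)) ?(ltnW sJlt) //=.
rewrite addnC -addnS leq_add2l big_ltn // (leq_trans (ltr _ sJlt)) //.
rewrite (nth_map (mono0 N, j)) ?size_zip -?cardE ?szJ ?minnn //.
rewrite nth_zip -?cardE ?szJ //= [in nth j _ _]sJ_index // nth_index ?mem_enum //.
exact: leq_addr.
Qed.

Lemma Psi_regrade u : Psi q u = regrade (weightB q u) (weightK q) (Psi q1 u).
Proof.
case: u => [[a ls] b]; rewrite /Psi /extK /regrade -map_comp /PsiGen /=.
case: ls => [|l ls].
  rewrite /= /weightB /weightK /= enum_set0 /= !tw_q1 !addm0 !twm0 !tw0m !mulr1.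
  by rewrite add0m divff ?mscal_neq0.
move: (l :: ls) => {l} {}ls; rewrite !map_flatten -!map_comp; congr flatten.
apply/eq_in_map => J; rewrite mem_filter => /andP[/eqP szJ _] /=.
rewrite -!map_comp; apply/eq_in_map => r rls /=; congr pair.
rewrite !tw_q1 /mu !mprod_q1 /weightB /weightK /= (mscal_ext hq0) ?(Psi_totalm szJ rls) //.
by rewrite /mscal !(mulr1, divr1).
Qed.

Lemma ofLK (L : seq (mono N)) : (1 < size L)%N -> (ofL L).1.1 :: (ofL L).1.2 ++ [:: (ofL L).2] = L.
Proof.
case: L => // a; case/lastP => // ls b _.
rewrite /ofL /= size_rcons subSS subn1 /= last_rcons -cats1 take_size_cat //.
Qed.

(** Merging two neighbours divides the scalar of the word by exactly their twist. In degree 0 the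
    merged list has a single entry, which [ofL] would use both as head and as last factor; hence the
    positive degree. *)
Lemma barD_regrade u : (0 < size u.1.2)%N ->
  barD q u = regrade (weightB q u) (weightB q) (barD q1 u).
Proof.
case: u => [[a ls] b]; rewrite -[size _]/(size ls) => ls0; rewrite /barD /regrade; cbv zeta.
have -> : weightB q (a, ls, b) = mscal q ((a, ls, b).1.1 :: (a, ls, b).1.2 ++ [:: (a, ls, b).2]) by [].
have : size ((a, ls, b).1.1 :: (a, ls, b).1.2 ++ [:: (a, ls, b).2]) = (size ls).+2.
  by rewrite /= size_cat addn1.
move: (_ :: _ ++ _) => L szL; rewrite -map_comp.
apply/eq_in_map => i; rewrite mem_iota => /andP[_ il] /=; congr pair.
have {}il : (i <= size ls)%N by move: il; rewrite add0n ltnS.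
have iL : (i.+1 < size L)%N by rewrite szL ltnS.
have EL : L = take i L ++ nth (mono0 N) L i :: nth (mono0 N) L i.+1 :: drop i.+2 L.
  by rewrite -!drop_nth ?cat_take_drop // ltnW.
rewrite tw_q1 mulr1 /weightB [in RHS]ofLK; last first.
  rewrite size_cat size_takel /= ?size_drop szL; last exact: leq_trans il (leqW (leqnSn _)).
  by rewrite !subSS addnS subnKC.
rewrite mulrC; congr (_ * _).
rewrite [in mscal q L]EL; move: (take _ _) (nth _ _ _) (nth _ _ _) (drop _ _) => s1 x y s2.
rewrite !(mscal_cons, mscal_cat, mscal_nil) !(totalm_cons, totalm_cat, totalm_nil, addm0) !(twDl, twDr).
by field; rewrite !(tw_neq0, mscal_neq0).
Qed.

End Regrading.

(** * The antisymmetrization map for q = 1 *)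

Section LinearEval.
Variables (k : fieldType) (L : lmodType k).

(** Coefficient extraction is one instance ([coef_evl]); evaluation of components in a polynomial
    ring is the other one used below. *)
Definition evl (T : Type) (phi : T -> L) (v : vec k T) : L := \sum_(x <- v) x.1 *: phi x.2.

Lemma evl_cat (T : Type) (phi : T -> L) v w : evl phi (v ++ w) = evl phi v + evl phi w.
Proof. by rewrite /evl big_cat. Qed.

Lemma evl_seq1 (T : Type) (phi : T -> L) c t : evl phi [:: (c, t)] = c *: phi t.
Proof. by rewrite /evl big_seq1. Qed.

Lemma evl_linext (T U : Type) (phi : U -> L) (f : T -> vec k U) (v : vec k T) :
  evl phi (linext f v) = evl (fun t => evl phi (f t)) v.
Proof.
rewrite /evl /linext big_flatten big_map; apply: eq_bigr => x _.
by rewrite big_map scaler_sumr; apply: eq_bigr => y _; rewrite scalerA.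
Qed.

Lemma evl_map (I T : Type) (phi : T -> L) (r : seq I) (c : I -> k) (t : I -> T) :
  evl phi [seq (c i, t i) | i <- r] = \sum_(i <- r) c i *: phi (t i).
Proof. by rewrite /evl big_map. Qed.

Lemma evl_mapE (T U : Type) (phi : T -> L) (f : k * U -> k * T) (v : vec k U) (psi : U -> L) :
  (forall x, (f x).1 *: phi (f x).2 = x.1 *: psi x.2) ->
  evl phi (map f v) = evl psi v.
Proof. by move=> E; rewrite /evl big_map; apply: eq_bigr => x _; apply: E. Qed.

Lemma eq_evl (T : Type) (phi psi : T -> L) v : phi =1 psi -> evl phi v = evl psi v.
Proof. by move=> E; apply: eq_bigr => x _; rewrite E. Qed.

End LinearEval.

Lemma coef_evl (k : fieldType) (T : eqType) (v : vec k T) t :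
  coef v t = evl (fun u => (u == t)%:R : k^o) v.
Proof.
rewrite /coef /evl big_mkcond; apply: eq_bigr => x _.
by case: eqP => _; rewrite ?scaler0 // /GRing.scale /= mulr1.
Qed.

(** * Signed sums over the symmetric group *)

Section Alternating.
Variables (k : fieldType) (L : lmodType k).

(** Multiplication by the transposition exchanges even and odd permutations and preserves [G]. Terms
    cancel in pairs, which is valid in characteristic 2 as well. *)
Lemma sum_sign_tperm n (i j : 'I_n) (G : 'S_n -> L) : i != j ->
  (forall s, G (tperm i j * s)%g = G s) -> \sum_s (-1) ^+ odd_perm s *: G s = 0.
Proof.
move=> nij GE; pose t := tperm i j.
have oddMt s: (t * s)%g = ~~ s :> bool by rewrite odd_permM odd_tperm nij.
rewrite (bigID (@odd_perm _)) /=.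
apply: canLR (subrK _) _; rewrite add0r -sumrN.
rewrite (reindex_inj (mulgI t)); apply: eq_big => //= s.
by rewrite oddMt GE => /negPf->; rewrite scaleN1r scale1r.
Qed.

(** As in a Laplace expansion, permutations are sorted by the image [j] of [i0]. Injectivity and a
    count show that [lift_perm] gives each permutation once. *)
Lemma sum_sign_lift n (i0 : 'I_n.+1) (G : 'S_n.+1 -> L) :
  \sum_s (-1) ^+ odd_perm s *: G s =
  \sum_(j < n.+1) \sum_(s : 'S_n)
     ((-1) ^+ i0 * (-1) ^+ j * (-1) ^+ odd_perm s) *: G (lift_perm i0 j s).
Proof.
rewrite pair_bigA /=.
pose f (p : 'I_n.+1 * 'S_n) := lift_perm i0 p.1 p.2.
have finj : injective f.
  move=> [j s] [j' s'] /= E; have Ej : j = j'.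
    by have := congr1 (fun u : 'S_n.+1 => u i0) E; rewrite /f /= !lift_perm_id.
  rewrite -{}Ej in E *; congr pair; apply/permP => x.
  have := congr1 (fun u : 'S_n.+1 => u (lift i0 x)) E.
  by rewrite /f /= !lift_perm_lift => /lift_inj.
have fbij : bijective f.
  apply: inj_card_bij finj _.
  by rewrite card_prod !card_Sn card_ord factS.
rewrite (reindex f); last exact: onW_bij.
apply: eq_bigr => p _; congr (_ *: _); rewrite odd_lift_perm !signr_addb.
by rewrite !signr_odd.
Qed.

End Alternating.

Section Untwisted.
Variables (k : fieldType) (N : nat) (L : lmodType k).
Implicit Types (a b : mono N) (ls : seq (mono N)) (J : {set 'I_N}).
Local Notation q1 := (@q1 k N).

Lemma evl_extK_q1 (phi : Kb N -> L) a b v :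
  evl phi (extK q1 a b v) = evl (fun u => phi (addm a u.1.1, u.1.2, addm u.2 b)) v.
Proof. by apply: evl_mapE => x /=; rewrite !tw_q1 !mulr1. Qed.

Lemma evl_extB_q1 (phi : Bb N -> L) a b v :
  evl phi (extB q1 a b v) = evl (fun u => phi (addm a u.1.1, u.1.2, addm u.2 b)) v.
Proof. by apply: evl_mapE => x /=; rewrite !tw_q1 !mulr1. Qed.

(** A tuple of free length n replaces [enum J], so that the permutations live in 'S_n and not in a
    group indexed by [size (enum J)]. *)
Lemma evl_Phi_q1 (phi : Bb N -> L) n (js : n.-tuple 'I_N) J a b : enum J = js ->
  evl phi (Phi q1 (a, J, b)) =
  \sum_(s : 'S_n) (-1) ^+ odd_perm s *:
     phi (a, [seq ev (tnth js (s i)) | i <- enum 'I_n], b).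
Proof.
move=> EJ; have En : n = size (enum J) by rewrite EJ size_tuple.
subst n; have -> : js = in_tuple (enum J) by apply: val_inj.
rewrite /Phi evl_extB_q1 /PhiGen evl_map big_enum /=.
apply: eq_big => s; first by rewrite inE.
by rewrite /qpi !mprod_q1 divr1 mulr1 addm0 add0m.
Qed.

Lemma evl_dK_q1 (phi : Kb N -> L) n (js : n.-tuple 'I_N) J a b : enum J = js ->
  evl phi (dK q1 (a, J, b)) =
  \sum_(i < n) (-1) ^+ i *: (phi (addm a (ev (tnth js i)), J :\ tnth js i, b)
                            - phi (a, J :\ tnth js i, addm (ev (tnth js i)) b)).
Proof.
move=> EJ; have En : n = size (enum J) by rewrite EJ size_tuple.
subst n; have -> : js = in_tuple (enum J) by apply: val_inj.
rewrite /dK evl_extK_q1 /dKgen evl_cat !evl_map !big_enum /= -big_split.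
apply: eq_bigr => i _ /=.
by rewrite !prod_q1 !mulr1 addm0 !add0m scaleNr scalerBr.
Qed.

Lemma ofL_cons a ls b : ofL (a :: ls ++ [:: b]) = (a, ls, b).
Proof. by rewrite /ofL /= size_cat addn1 subSS subn1 /= take_size_cat // last_cat. Qed.

Lemma evl_barD_q1 (phi : Bb N -> L) l ls a b :
  evl phi (barD q1 (a, l :: ls, b)) =
  phi (addm a l, ls, b) +
  \sum_(i < size ls) (-1) ^+ i.+1 *:
    phi (a, take i (l :: ls) ++ addm (nth (mono0 N) (l :: ls) i) (nth (mono0 N) ls i)
            :: drop i.+1 ls, b) +
  (-1) ^+ (size ls).+1 *: phi (a, take (size ls) (l :: ls), addm (last l ls) b).
Proof.
rewrite /barD evl_map -[iota _ _]/(index_iota 0 (size ls).+2) big_mkord.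
rewrite big_ord_recl big_ord_recr /= addrA; congr (_ + _ + _).
- by rewrite tw_q1 expr0 mulr1 scale1r drop0 (ofL_cons (addm a l)).
- apply: eq_bigr => i _; rewrite /bump /= tw_q1 mulr1; congr (_ *: phi _).
  have ils : (i < size (l :: ls))%N by rewrite /= ltnS ltnW.
  rewrite -[RHS]ofL_cons -catA cat_cons -[l :: ls ++ _]cat_cons take_cat !nth_cat ils ltn_ord.
  rewrite drop_cat; case: ifP => // /negbT; rewrite -leqNgt => h.
  (* At the last inner face nothing of [ls] is left after the merged factor, only the coefficient
     [b]. *)
  have -> : (i.+1 - size ls = 0)%N by apply/eqP; rewrite subn_eq0 ltn_ord.
  by rewrite drop0 drop_oversize.
- rewrite tw_q1 mulr1; congr (_ *: phi _).
  rewrite -[RHS]ofL_cons -[l :: ls ++ _]cat_cons take_cat !nth_cat /= ltnSn ltnn subnn.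
  by rewrite /bump add0n add1n drop_oversize ?size_cat ?addn1 // [last l ls](last_nth (mono0 N)).
Qed.

Lemma evl_barD_q1_nth (phi : Bb N -> L) n ls a b : size ls = n.+1 ->
  evl phi (barD q1 (a, ls, b)) =
  phi (addm a (nth (mono0 N) ls 0), behead ls, b) +
  \sum_(i < n) (-1) ^+ i.+1 *:
    phi (a, take i ls ++ addm (nth (mono0 N) ls i) (nth (mono0 N) ls i.+1) :: drop i.+2 ls, b) +
  (-1) ^+ n.+1 *: phi (a, take n ls, addm (nth (mono0 N) ls n) b).
Proof. by case: ls => //= l ls [<-]; rewrite evl_barD_q1 (last_nth (mono0 N)). Qed.

Lemma take_enum_ord n (i : nat) (x : 'I_n) : x \in take i (enum 'I_n) -> (x < i)%N.
Proof.
move=> /(map_f val); rewrite map_take val_enum_ord take_iota mem_iota add0n leq_min.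
by case/andP => _ /andP[].
Qed.

Lemma drop_enum_ord n (i : nat) (x : 'I_n) : x \in drop i (enum 'I_n) -> (i <= x)%N.
Proof.
move=> /(map_f val); rewrite map_drop val_enum_ord drop_iota mem_iota.
by case/andP; rewrite add0n.
Qed.

Lemma nth_map_enum_ord n (T : Type) (x0 : T) (F : 'I_n -> T) (i : 'I_n) :
  nth x0 [seq F j | j <- enum 'I_n] i = F i.
Proof. by rewrite (nth_map i) ?size_enum_ord // nth_ord_enum. Qed.

(* Interior faces of the bar differential are symmetric under exchange of the
   two merged factors, so they cancel in the alternating sum. *)
Lemma sum_interior_face n (js : n.+1.-tuple 'I_N) (i : 'I_n) (phi : seq (mono N) -> L) :
  \sum_(s : 'S_n.+1) (-1) ^+ odd_perm s *:
    (let l := [seq ev (tnth js (s j)) | j <- enum 'I_n.+1] in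
     phi (take i l ++ addm (nth (mono0 N) l i) (nth (mono0 N) l i.+1) :: drop i.+2 l)) = 0.
Proof.
pose i1 : 'I_n.+1 := widen_ord (leqnSn n) i; pose i2 := lift ord0 i.
have n12 : i1 != i2 by rewrite -val_eqE /= /bump /= neq_ltn ltnSn.
apply: (@sum_sign_tperm _ _ _ i1 i2) => // s /=; congr phi.
have e1 t : nth (mono0 N) [seq ev (tnth js (t j)) | j <- enum 'I_n.+1] i = ev (tnth js (t i1)).
  exact: (nth_map_enum_ord (mono0 N) (fun j => ev (tnth js (t j))) i1).
have e2 t : nth (mono0 N) [seq ev (tnth js (t j)) | j <- enum 'I_n.+1] i.+1 = ev (tnth js (t i2)).
  exact: (nth_map_enum_ord (mono0 N) (fun j => ev (tnth js (t j))) i2).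
rewrite !e1 !e2 !permM tpermL tpermR addmC.
have tk m (F : 'I_n.+1 -> mono N) := map_take m F (enum 'I_n.+1).
have dr m (F : 'I_n.+1 -> mono N) := map_drop m F (enum 'I_n.+1).
rewrite -!tk -!dr; congr (_ ++ _ :: _).
  apply/eq_in_map => x /take_enum_ord xi; rewrite permM tpermD // -val_eqE /=.
    by rewrite neq_ltn xi orbT.
  by rewrite /bump /= neq_ltn (ltn_trans xi) ?orbT.
apply/eq_in_map => x /drop_enum_ord xi; rewrite permM tpermD // -val_eqE /=.
  by rewrite neq_ltn (ltn_trans _ xi).
by rewrite /bump /= neq_ltn xi.
Qed.

(** Matches removal of an index in the Koszul differential with the relabelling in [lift_perm]. Both
    position lists are strictly increasing with the same members, hence equal. *)
Lemma enum_setD1_lift n (js : n.+1.-tuple 'I_N) (i : 'I_n.+1) J : enum J = js ->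
  enum (J :\ tnth js i) = [tuple tnth js (lift i j) | j < n].
Proof.
move=> EJ; rewrite enum_setD1 EJ.
have inj : injective (tnth js).
  move=> x y; have j0 := tnth js i; rewrite !(tnth_nth j0) => /eqP.
  by rewrite nth_uniq ?size_tuple -?EJ ?enum_uniq // => /eqP/val_inj.
rewrite -[X in filter _ X](map_tnth_enum js) filter_map /=.
under eq_filter do rewrite /= (inj_eq inj).
rewrite -[X in _ = X]/[seq tnth js (lift i j) | j <- enum 'I_n].
rewrite (map_comp (tnth js) (lift i)); congr map; apply: (inj_map val_inj).
apply: (irr_sorted_eq ltn_trans ltnn).
- rewrite sorted_map sorted_filter //; first by move=> x y z; apply: ltn_trans.
  by have := iota_ltn_sorted 0 n.+1; rewrite -val_enum_ord sorted_map.
- rewrite -map_comp (eq_map (g := bump i \o val)) // map_comp val_enum_ord.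
  rewrite sorted_map; apply: sub_sorted (iota_ltn_sorted 0 n) => x y /=.
  by rewrite !ltnNge leq_bump2.
move=> x; apply/mapP/mapP => -[y]; rewrite ?mem_filter => yi ->.
  move: yi => /andP[yi _]; exists y => //.
  case: (unliftP i y) yi => [z ->|->]; last by rewrite eqxx.
  by rewrite map_f // mem_enum.
case/mapP: yi => z _ ->; exists (lift i z) => //.
by rewrite mem_filter mem_enum eq_sym neq_lift.
Qed.

Lemma Phi_chain_q1 p a b J (phi : Bb N -> L) : #|J| = p.+1 ->
  evl phi (linext (barD q1) (Phi q1 (a, J, b))) =
  evl phi (linext (Phi q1) (dK q1 (a, J, b))).
Proof.
move=> szJ; have szE : size (enum J) == p.+1 by rewrite -cardE szJ.
pose js := Tuple szE; have EJ : enum J = js by [].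
rewrite !evl_linext (evl_Phi_q1 _ _ _ EJ) (evl_dK_q1 _ _ _ EJ).
have szF (F : 'I_p.+1 -> mono N) : size [seq F i | i <- enum 'I_p.+1] = p.+1.
  by rewrite size_map size_enum_ord.
under eq_bigr => s _ do rewrite (evl_barD_q1_nth _ _ _ (szF _)) !scalerDr.
rewrite !big_split /= [X in _ + X + _ = _](_ : _ = 0) ?addr0; last first.
  under eq_bigr do rewrite scaler_sumr.
  rewrite exchange_big big1 //= => i _.
  under eq_bigr do rewrite scalerA mulrC -scalerA.
  rewrite -scaler_sumr.
  by rewrite (sum_interior_face js i (fun l => phi (a, l, b))) scaler0.
(* The first bar face is expanded along the image of the first position, the last face along that of
   the last; this image is the index removed by the Koszul differential. *)
rewrite (sum_sign_lift ord0) (sum_sign_lift ord_max) -big_split.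
apply: eq_bigr => j _ /=.
pose js' := [tuple tnth js (lift j x) | x < p].
have EJ' : enum (J :\ tnth js j) = js' by apply: enum_setD1_lift.
rewrite !(evl_Phi_q1 _ _ _ EJ') scalerBr !scaler_sumr -sumrN; congr (_ + _).
  apply: eq_bigr => s _; rewrite scalerA expr0 mul1r.
  rewrite !enum_ordSl /= lift_perm_id -map_comp; congr (_ *: phi (_, _, _)).
  by apply: eq_map => x /=; rewrite lift_perm_lift tnth_mktuple.
apply: eq_bigr => s _; rewrite !scalerA -scaleNr; congr (_ *: phi (_, _, addm _ b)).
(* The face sign (-1)^{p+1} and the sign (-1)^p of the last position combine to -1, the sign of the
   right-hand Koszul term. *)
- by rewrite /= mulrC !mulrA -exprD -[(-1) ^+ (_ + _)]signr_odd oddD /= addNb addbb expr1 !mulNr mul1r.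
- rewrite enum_ordSr map_rcons -cats1 take_size_cat 2?size_map ?size_enum_ord //.
  rewrite -map_comp; apply: eq_map => x /=; rewrite tnth_mktuple -(lift_perm_lift ord_max).
  congr (ev (tnth js (lift_perm _ _ _ _))).
  by apply: ord_inj; rewrite lift_max.
have := nth_map_enum_ord (mono0 N) (fun i => ev (tnth js (lift_perm ord_max j s i))) ord_max.
by rewrite lift_perm_id.
Qed.

Lemma Phi_lift_q1 a b (phi : mono N -> L) :
  evl phi (linext (epsB q1) (Phi q1 (a, set0, b))) =
  evl phi (linext (epsK q1) [:: (1, (a, set0, b))]).
Proof.
rewrite !evl_linext (@evl_Phi_q1 _ 0 [tuple]) ?enum_set0 //.
rewrite (big_pred1 1%g) => [|s]; last by apply/esym/eqP/permP => -[].
by rewrite odd_perm1 expr0 [RHS]evl_seq1.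
Qed.

End Untwisted.

(** * Divided differences *)

Section DividedDifferences.
Variables (N : nat) (R : comNzRingType) (x y : 'I_N -> R).
Implicit Types (l a b : mono N) (ls : seq (mono N)) (j : 'I_N) (js : seq 'I_N).

(* The monomial l evaluated at (y_0, ..., y_{c-1}, x_c, ..., x_{N-1}). *)
Definition mixev (c : nat) l : R := \prod_(i < N) (if (i < c)%N then y i else x i) ^+ l i.

(** The quotient by x_j - y_j is written as a geometric sum, so it makes sense in any commutative
    ring. Since r < l_j, the exponent of y_j is not truncated. *)
Definition divdiff j l : R :=
  (\prod_(i < N | i != j) (if (i < j)%N then y i else x i) ^+ l i) *
  \sum_(r < l j) x j ^+ r * y j ^+ (l j - 1 - r).

Definition divprod js ls : R := \prod_(p <- zip ls js) divdiff p.2 p.1.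

Lemma mixevD c a b : mixev c (addm a b) = mixev c a * mixev c b.
Proof. by rewrite /mixev -big_split; apply: eq_bigr => i _; rewrite ffunE exprD. Qed.

Lemma mixev0 c : mixev c (mono0 N) = 1.
Proof. by rewrite /mixev big1 // => i _; rewrite ffunE. Qed.

Lemma mixev_split j l : mixev j l =
  (\prod_(i < N | i != j) (if (i < j)%N then y i else x i) ^+ l i) * x j ^+ l j.
Proof. by rewrite /mixev (bigD1 j) //= ltnn mulrC. Qed.

Lemma mixevS_split j l : mixev j.+1 l =
  (\prod_(i < N | i != j) (if (i < j)%N then y i else x i) ^+ l i) * y j ^+ l j.
Proof.
rewrite /mixev (bigD1 j) //= ltnSn mulrC; congr (_ * _).
by apply: eq_bigr => i ij; rewrite ltnS leq_eqVlt val_eqE (negPf ij).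
Qed.

Lemma divdiffE j l : (x j - y j) * divdiff j l = mixev j l - mixev j.+1 l.
Proof.
rewrite mixev_split mixevS_split -mulrBr subrXX /divdiff mulrCA; congr (_ * (_ * _)).
(* [subrXX] lists the powers of x_j in decreasing order. *)
rewrite (reindex_inj rev_ord_inj) /=; apply: eq_bigr => r _.
by congr (_ ^+ _ * _ ^+ _); have := ltn_ord r; lia.
Qed.

(** The one-variable Leibniz rule, obtained by cutting the range of r at m instead of dividing by u
    - v. *)
Lemma sum_geomD m n (u v : R) : \sum_(r < m + n) u ^+ r * v ^+ (m + n - 1 - r) =
  (\sum_(r < m) u ^+ r * v ^+ (m - 1 - r)) * v ^+ n +
  u ^+ m * \sum_(r < n) u ^+ r * v ^+ (n - 1 - r).
Proof.
rewrite big_split_ord /= mulr_suml mulr_sumr; congr (_ + _); apply: eq_bigr => r _.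
  rewrite -mulrA -exprD; congr (_ * _ ^+ _); have := ltn_ord r; lia.
rewrite mulrA -exprD; congr (_ * _ ^+ _); have := ltn_ord r; lia.
Qed.

Lemma divdiffD j a b :
  divdiff j (addm a b) = divdiff j a * mixev j.+1 b + mixev j a * divdiff j b.
Proof.
rewrite mixev_split mixevS_split /divdiff ffunE sum_geomD.
under eq_bigr do rewrite ffunE exprD.
rewrite big_split /=; ring.
Qed.

Lemma divprod_cons j js l ls : divprod (j :: js) (l :: ls) = divdiff j l * divprod js ls.
Proof. by rewrite /divprod /= big_cons. Qed.

(* With c = 0, barsum and koszulsum are the components of Psi o delta and d o Psi
   on l_0, ..., l_p at the set enumerated by js; the lower bound c on the inserted
   index makes the induction on js possible. *)
Definition barsum c js ls : R :=
  mixev c (nth (mono0 N) ls 0) * divprod js (behead ls) +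
  \sum_(i < size js) (-1) ^+ i.+1 *
    divprod js (take i ls ++ addm (nth (mono0 N) ls i) (nth (mono0 N) ls i.+1) :: drop i.+2 ls) +
  (-1) ^+ (size js).+1 * (divprod js (take (size js) ls) * mixev N (nth (mono0 N) ls (size js))).

(** On an increasing enumeration this adjoins [j] to the set; see [enum_setU1]. *)
Definition insj j js := let n := count (fun i : 'I_N => (i < j)%N) js in
  take n js ++ j :: drop n js.

Definition koszulsum c js ls : R :=
  \sum_(j < N | (c <= j)%N && (j \notin js))
    (-1) ^+ count (fun i : 'I_N => (i < j)%N) js * (x j - y j) * divprod (insj j js) ls.

(** The Leibniz rule splits the first inner face in two. The part D_j l * d_j l' joins the outer
    face; the part d_j l * D_{j+1} l' becomes the outer face of the tail, whose lower bound is
    therefore [j.+1]. *)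
Lemma barsum_cons c j js l l' ls : size ls = size js ->
  barsum c (j :: js) (l :: l' :: ls) =
  (mixev c l - mixev j l) * divprod (j :: js) (l' :: ls)
  - divdiff j l * barsum j.+1 js (l' :: ls).
Proof.
move=> szl; rewrite /barsum [size (j :: js)]/= big_ord_recl /= !divprod_cons.
rewrite ?take0 ?drop0 divdiffD.
under eq_bigr => i _ do rewrite /bump /= divprod_cons exprS mulN1r mulNr mulrCA.
rewrite sumrN -mulr_sumr [in X in _ + X = _]exprS.
move: (\sum_(i < size js) _) => S; ring.
Qed.

Lemma telescope_mixev c (m : nat) l : (c <= m <= N)%N ->
  \sum_(j < N | (c <= j < m)%N) (mixev j l - mixev j.+1 l) = mixev c l - mixev m l.
Proof.
case/andP => cm mN.
transitivity (\sum_(c <= j < m) (mixev j l - mixev j.+1 l)).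
  rewrite (big_nat_widen _ _ _ _ _ mN) big_geq_mkord.
  by apply: eq_bigl => j; rewrite andbC.
rewrite (telescope_sumr_eq (fun i => - mixev i l)) // => [|i _]; rewrite opprK addrC //.
Qed.

(** Induction along [barsum_cons]: insertions before the head j telescope to D_c - D_j on the first
    factor, while insertions after it pass j with one extra sign and form the sum for the tail. *)
Lemma koszulsum_barsum c js ls :
  sorted (fun i j : 'I_N => (i < j)%N) js -> all (fun j : 'I_N => (c <= j)%N) js ->
  (c <= N)%N -> size ls = (size js).+1 -> koszulsum c js ls = barsum c js ls.
Proof.
have tr : transitive (fun i j : 'I_N => (i < j)%N) by move=> u v w; exact: ltn_trans.
elim: js c ls => [|j js IH] c [|l ls] //= sjs cjs cN [] szl.
  (* With no index present, all insertions telescope to D_c - D_N, the two outer faces. *)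
  case: ls szl => // _; rewrite /barsum /koszulsum /= /divprod /= !big_nil big_ord0.
  under eq_bigr do rewrite big_seq1 /= expr0 mul1r divdiffE.
  rewrite (eq_bigl (fun j : 'I_N => (c <= j < N)%N)) => [|j]; last by rewrite ltn_ord.
  rewrite telescope_mixev ?cN ?leqnn //; ring.
case: ls szl => // l' ls [] szl; rewrite barsum_cons //.
case/andP: cjs => cj _; move: sjs; rewrite (path_sortedE tr) => /andP[/allP jjs sjs].
rewrite -(IH j.+1) //=; last by rewrite szl.
  rewrite /koszulsum (bigID (fun i : 'I_N => (i < j)%N)) /=; congr (_ + _).
    rewrite -telescope_mixev ?cj ?(ltnW (ltn_ord j)) // mulr_suml.
    apply: eq_big => i.
      case: (ltnP i j) => ij; last by rewrite !andbF.
      rewrite !andbT inE negb_or -val_eqE neq_ltn ij /=.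
      case: (c <= i)%N => //=; apply/negP => /jjs; by rewrite ltnNge ltnW.
    case/andP => _ ij; rewrite -divdiffE /insj /= ltnNge (ltnW ij) /=.
    have -> : count (fun i0 : 'I_N => (i0 < i)%N) js = 0%N.
      apply/eqP; rewrite -leqn0 leqNgt -has_count; apply/hasPn => u /jjs ju.
      by rewrite -leqNgt ltnW // (ltn_trans ij).
    by rewrite expr0 mul1r /= divprod_cons mulrA.
  rewrite -mulNr mulr_sumr; apply: eq_big => i.
    rewrite -leqNgt inE negb_or -val_eqE /= [in RHS]ltn_neqAle eq_sym.
    case: (leqP j i) => ji; rewrite ?andbF ?andbT //.
    by rewrite (leq_trans cj ji).
  rewrite -leqNgt inE negb_or -val_eqE => /andP[/andP[_ /andP[nij _]] ji].
  have {nij}ji : (j < i)%N by rewrite ltn_neqAle eq_sym nij.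
  rewrite /insj /= ji /= divprod_cons exprS; ring.
by apply/allP => u /jjs.
Qed.

Lemma sum_rtuples_prod (g : nat -> nat -> R) bs :
  \sum_(r <- rtuples bs) \prod_(s < size bs) g s (nth 0%N r s) =
  \prod_(s < size bs) \sum_(u < nth 0%N bs s) g s u.
Proof.
elim: bs g => [|b bs IH] g; first by rewrite /= big_seq1 !big_ord0.
rewrite [LHS]big_allpairs_dep /= big_ord_recl /= -(big_mkord predT (g 0%N)) /index_iota subn0 mulr_suml.
apply: eq_bigr => u _; rewrite -(IH (fun s => g s.+1)) mulr_sumr.
by apply: eq_bigr => r _; rewrite big_ord_recl.
Qed.

(** The monomial x^Q y^Qhat factors into contributions of the separate l^s, each involving only r_s,
    so the sum over r becomes a product of geometric sums. *)
Lemma sum_rtuples_mixev (J : {set 'I_N}) ls (j0 : 'I_N) : #|J| = size ls ->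
  \sum_(r <- rtuples [seq (p.1 : mono N) p.2 | p : mono N * 'I_N <- zip ls (enum J)])
    mixev 0 (Qv ls J r) * mixev N (Qhat ls J r) = divprod (enum J) ls.
Proof.
move=> szJ; have szE : size (enum J) = size ls by rewrite -cardE.
set bs := [seq _ | _ <- _].
have szb : size bs = size ls by rewrite size_map size_zip szE minnn.
have nthb s : (s < size ls)%N -> nth 0%N bs s = nth (mono0 N) ls s (nth j0 (enum J) s).
  by move=> sls; rewrite (nth_map (mono0 N, j0)) ?size_zip ?szE ?minnn // nth_zip.
pose E s := \prod_(i < N | i != nth j0 (enum J) s)
  (if (i < nth j0 (enum J) s)%N then y i else x i) ^+ nth (mono0 N) ls s i.
pose g s u := E s * (x (nth j0 (enum J) s) ^+ u * y (nth j0 (enum J) s) ^+ (nth 0%N bs s - 1 - u)).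
transitivity (\sum_(r <- rtuples bs) \prod_(s < size bs) g s (nth 0%N r s)); last first.
  rewrite sum_rtuples_prod /divprod (big_nth (mono0 N, j0)) size_zip szE minnn big_mkord szb.
  apply: eq_bigr => s _; rewrite nth_zip //= /divdiff -nthb // mulr_sumr.
  by apply: eq_bigr.
rewrite big_seq [RHS]big_seq; apply: eq_bigr => r /mem_rtuples[_ rb].
pose js s := nth j0 (enum J) s; pose l s := nth (mono0 N) ls s.
(* Shares of l^s in Q and Qhat: variables above j_s go left, those below go right, and x_{j_s} is
   divided as r_s on the left, one unit in the wedge, the rest on the right. *)
pose alpha s (i : 'I_N) := (if i == js s then nth 0 r s else if i < js s then 0 else l s i)%N.
pose beta s (i : 'I_N) := (if i == js s then l s i - 1 - nth 0 r s else if i < js s then l s i else 0)%N.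
transitivity (\prod_(s < size bs) \prod_(i < N) (x i ^+ alpha s i * y i ^+ beta s i)); last first.
  apply: eq_bigr => s _; rewrite (bigD1 (js s)) //= /alpha /beta eqxx mulrC /g /E.
  rewrite nthb -?szb //; congr (_ * _); apply: eq_bigr => i /negPf nij.
  by rewrite -/(js s) nij; case: ifP => _; rewrite expr0 ?mulr1 ?mul1r.
rewrite exchange_big /mixev -big_split; apply: eq_bigr => i _ /=.
rewrite ltn_ord big_split !prodrXr /=.
have jsE s : (s < size bs)%N -> (i == js s) = (i \in J) && (s == sJ J i).
  move=> sb; have sJs : (s < #|J|)%N by rewrite szJ -szb.
  apply/eqP/andP => [->|[iJ /eqP ->]].
    by rewrite sJ_nth // -mem_enum mem_nth // szE -szb.
  by rewrite /js sJ_index // nth_index ?mem_enum.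
have jsltE s : (s < size bs)%N -> (js s < i)%N = (s < sJ J i)%N.
  by move=> sb; rewrite /js nth_enum_set_lt // szJ -szb.
have sJle : (sJ J i <= size bs)%N by rewrite sJE szb -szE count_size.
have sJlt : i \in J -> (sJ J i < size bs)%N.
  by move=> iJ; rewrite sJ_index // szb -szE index_mem mem_enum.
have Ea : Qv ls J r i = (\sum_(s < size bs) alpha s i)%N.
  rewrite ffunE (big_ord_widen _ (fun t => nth (mono0 N) ls t i) sJle).
  rewrite [in RHS](bigID (fun s : 'I_(size bs) => s < sJ J i)%N) /= addnC.
  congr (_ + _)%N.
    apply: eq_bigr => s ssJ; rewrite /alpha jsE // ltnNge ltnW ?jsltE // ltn_eqF //.
    by rewrite andbF.
  case: ifP => iJ; last first.
    rewrite big1 // => s; rewrite -jsltE // -leqNgt => ij.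
    rewrite /alpha jsE // iJ /= ltn_neqAle ij andbT.
    by rewrite val_eqE jsE // iJ.
  rewrite (bigD1 (Ordinal (sJlt iJ))) ?ltnn //= /alpha jsE ?sJlt // iJ eqxx big1 ?addn0 //.
  move=> s /andP[]; rewrite -jsltE // -leqNgt => ij; rewrite -val_eqE /= => ns.
  by rewrite jsE // iJ (negPf ns) ltn_neqAle ij andbT val_eqE jsE // iJ ns.
have Eb : Qhat ls J r i = (\sum_(s < size bs) beta s i)%N.
  rewrite ffunE Ea; apply/eqP; rewrite -subnDA.
  (* Writing the total as a sum of all shares makes the truncated subtractions in [Qhat] exact. *)
  have -> : (\sum_(t < size ls) nth (mono0 N) ls t i = \sum_(s < size bs) beta s i +
      (\sum_(s < size bs) alpha s i + (i \in J)))%N.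
    have -> : ((i \in J) = \sum_(s < size bs) (i == js s) :> nat)%N.
      case iJ: (i \in J); last by rewrite big1 // => s _; rewrite jsE // iJ.
      rewrite (bigD1 (Ordinal (sJlt iJ))) //= jsE ?sJlt // iJ eqxx big1 // => s ns.
      by rewrite jsE // iJ; move: ns; rewrite -val_eqE /= => /negPf ->.
    rewrite -!big_split /= -szb; apply: eq_bigr => s _; rewrite /alpha /beta.
    case: eqP => [ei|_]; last by case: ifP => _; rewrite ?addn0.
    have := rb s (ltn_ord s); rewrite nthb -?szb // -/(js s) -ei -/(l s); lia.
  by rewrite addnK.
by rewrite Ea Eb.
Qed.

End DividedDifferences.

(** * The map Psi for q = 1 *)

Section Insertion.
Variable N : nat.
Implicit Types (J : {set 'I_N}) (j : 'I_N).

Lemma enum_setU1 J j : j \notin J -> enum (j |: J) = insj j (enum J).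
Proof.
move=> jJ; have tr : transitive (fun i j : 'I_N => (i < j)%N) by move=> u v w; exact: ltn_trans.
apply: (irr_sorted_eq tr) => [i||| i]; rewrite ?ltnn ?sorted_enum_set //.
  rewrite /insj; set n := count _ _.
  have nJ : (n <= size (enum J))%N by rewrite count_size.
  have sJ := sorted_enum_set J; have := sJ.
  rewrite -{1}(cat_take_drop n (enum J)) !sorted_pairwise // !pairwise_cat /=.
  case/and3P=> /allrelP lt12 -> ->; rewrite allrel_consr !andbT; apply/and3P; split.
  - apply/andP; split; last exact/allrelP.
    apply/allP => u /(nthP j)[t]; rewrite size_takel // => tn <-.
    by rewrite nth_take // (sorted_count_lt _ _ sJ) ?(leq_trans tn).
  - by [].
  apply/allP => u ud; move: (ud) => /(nthP j)[t]; rewrite size_drop => tn E.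
  have tJ : (n + t < size (enum J))%N by rewrite -ltn_subRL.
  rewrite ltn_neqAle leqNgt -E nth_drop (sorted_count_lt _ _ sJ) // -/n -leqNgt leq_addr andbT.
  apply: contraNneq jJ => /val_inj ->; by rewrite -mem_enum mem_nth.
rewrite mem_enum in_setU1 /insj mem_cat in_cons orbCA -mem_cat cat_take_drop.
by rewrite mem_enum.
Qed.

Lemma sJ_setU1 J j : sJ (j |: J) j = sJ J j.
Proof.
rewrite /sJ; apply: eq_card => i; rewrite !inE; case: eqP => [->|] //=.
by rewrite ltnn andbF.
Qed.

Lemma setU1_setD1 J J' j : j \notin J -> ((j \in J') && (J' :\ j == J)) = (J' == j |: J).
Proof.
move=> jJ; apply/andP/eqP => [[jJ' /eqP <-]|->]; first by rewrite setD1K.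
by rewrite setU11 setU1K.
Qed.

End Insertion.

(** * The chain condition for Psi, one component at a time *)

Section PsiChain.
Variables (k : fieldType) (N : nat) (R : comAlgType k) (x y : 'I_N -> R).
Implicit Types (a b : mono N) (ls : seq (mono N)) (J : {set 'I_N}) (j : 'I_N).
Local Notation q1 := (@q1 k N).

(** The J-component, with the left factor in the variables x (bound 0) and the right one in y (bound
    N). *)
Definition evK J (u : Kb N) : R := (u.1.2 == J)%:R * (mixev x y 0 u.1.1 * mixev x y N u.2).

Definition psiev J ls : R := if #|J| == size ls then divprod x y (enum J) ls else 0.

Lemma evl_sum_mull (I : finType) (U : Type) (c : I -> R) (phi : I -> U -> R) (v : vec k U) :
  evl (fun u => \sum_i c i * phi i u) v = \sum_i c i * evl (phi i) v.
Proof.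
rewrite /evl; under eq_bigr do rewrite scaler_sumr.
rewrite exchange_big; apply: eq_bigr => i _; rewrite mulr_sumr.
by apply: eq_bigr => u _; rewrite scalerAr.
Qed.

Lemma evl_mull (U : Type) (c : R) (phi : U -> R) (v : vec k U) :
  evl (fun u => c * phi u) v = c * evl phi v.
Proof. by rewrite /evl mulr_sumr; apply: eq_bigr => u _; rewrite scalerAr. Qed.

Lemma scale_sign n (z : R) : (-1) ^+ n *: z = (-1) ^+ n * z.
Proof. by rewrite -signr_odd scaler_sign -[in RHS]signr_odd mulr_sign. Qed.

Lemma mixev0_ev j : mixev x y 0 (ev j) = x j.
Proof.
rewrite /mixev (bigD1 j) //= ffunE eqxx expr1 big1 ?mulr1 // => i /negPf ij.
by rewrite ffunE ij.
Qed.

Lemma mixevN_ev j : mixev x y N (ev j) = y j.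
Proof.
rewrite /mixev (bigD1 j) //= ltn_ord ffunE eqxx expr1 big1 ?mulr1 // => i /negPf ij.
by rewrite ffunE ij.
Qed.

Lemma evl_PsiGen_q1 J ls : evl (evK J) (PsiGen q1 ls) = psiev J ls.
Proof.
rewrite /psiev; case: ls => [|l ls].
  rewrite evl_seq1 scale1r /evK /= !mixev0 !mulr1 eq_sym cards_eq0.
  by case: eqP => [->|] //; rewrite enum_set0 /divprod big_nil.
rewrite /PsiGen; move: (l :: ls) (isT : (0 < size (l :: ls))%N) => {l}{}ls ls0.
rewrite /evl big_flatten big_map big_filter big_enum_cond /=.
under eq_bigr => J' _ do rewrite big_map.
have vanish J' : J' != J ->
  \sum_(r <- rtuples [seq (p.1 : mono N) p.2 | p : mono N * 'I_N <- zip ls (enum J')])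
    (mu q1 ls J' r, (Qv ls J' r, J', Qhat ls J' r)).1 *:
    evK J (mu q1 ls J' r, (Qv ls J' r, J', Qhat ls J' r)).2 = 0.
  by move=> /negPf nJ; rewrite big1 // => r _; rewrite /evK /= nJ mul0r scaler0.
case: ifP => szJ; last first.
  rewrite big1 // => J' /eqP szJ'; apply: vanish; apply: contraFneq szJ => <-.
  by rewrite szJ'.
rewrite (bigD1 J) //= [X in _ + X]big1 ?addr0; last by move=> J' /andP[_]; apply: vanish.
have [j0 _] : exists j, j \in J by apply/set0Pn; rewrite -card_gt0 (eqP szJ).
rewrite -(sum_rtuples_mixev x y j0 (eqP szJ)).
by apply: eq_bigr => r _; rewrite /mu !mprod_q1 divr1 scale1r /evK /= eqxx mul1r.
Qed.

Lemma evl_Psi_q1 J a b ls :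
  evl (evK J) (Psi q1 (a, ls, b)) = mixev x y 0 a * mixev x y N b * psiev J ls.
Proof.
rewrite /Psi evl_extK_q1 /= -evl_PsiGen_q1 -evl_mull; apply: eq_evl => u.
by rewrite /evK /= !mixevD; ring.
Qed.

(** The matrix entry of the Koszul differential from component J' to component J: the left and right
    terms combine to multiplication by x_j - y_j. *)
Definition dKcoef J J' : R :=
  \sum_(j in J' | J' :\ j == J) (-1) ^+ sJ J' j * (x j - y j).

Lemma evl_dK_evK_q1 J u :
  evl (evK J) (dK q1 u) = \sum_J' dKcoef J J' * evK J' u.
Proof.
case: u => [[a J'] b]; rewrite (evl_dK_q1 _ _ _ (erefl : enum J' = in_tuple (enum J'))).
rewrite [RHS](bigD1 J') //= [X in _ = _ + X]big1 ?addr0; last first.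
  by move=> J'' /negPf nJ; rewrite /evK /= eq_sym nJ mul0r mulr0.
rewrite /dKcoef mulr_suml big_mkcondr -[RHS]big_enum /=.
rewrite -[X in _ = \sum_(j <- X) _]/(tval (in_tuple (enum J'))) [RHS]big_tuple.
apply: eq_bigr => i _; set j := tnth _ i.
have -> : nat_of_ord i = sJ J' j.
  by rewrite /j (tnth_nth j) sJ_nth // cardE.
rewrite scale_sign /evK /= eqxx !mixevD mixev0_ev mixevN_ev.
case: eqP => _ /=; rewrite ?mul1r ?mul0r; ring.
Qed.

(** The contributing sets J' are those obtained from J by adjoining one index, so the double sum
    collapses to a sum over inserted indices. *)
Lemma sum_dKcoef_psiev J ls p : size ls = p.+1 ->
  \sum_J' dKcoef J J' * psiev J' ls =
  if #|J| == p then koszulsum x y 0 (enum J) ls else 0.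
Proof.
move=> szl; rewrite /dKcoef.
under eq_bigr => J' _ do rewrite mulr_suml big_mkcondl big_mkcond.
rewrite exchange_big /=.
transitivity (\sum_(j | j \notin J) (-1) ^+ sJ J j * (x j - y j) * psiev (j |: J) ls).
  rewrite [RHS]big_mkcond; apply: eq_bigr => j _.
  case: ifP => jJ.
    rewrite (bigD1 (j |: J)) //= setU11 setU1K // eqxx sJ_setU1 big1 ?addr0 // => J' nJ'.
    by case: ifP => // D; case: ifP => // jJ'; rewrite -(setU1_setD1 J' jJ) jJ' D in nJ'.
  rewrite big1 // => J' _; case: eqP => // D; case: ifP => // _.
  by move: jJ; rewrite -D !inE eqxx.
rewrite /psiev szl; case: ifP => szJ.
  rewrite /koszulsum; apply: eq_big => j; rewrite ?mem_enum //= => jJ.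
  by rewrite cardsU1 jJ add1n eqSS szJ enum_setU1 // sJE.
by rewrite big1 // => j jJ; rewrite cardsU1 jJ add1n eqSS szJ mulr0.
Qed.

Lemma Psi_chain_q1 J a b ls p : size ls = p.+1 ->
  evl (evK J) (linext (Psi q1) (barD q1 (a, ls, b))) =
  evl (evK J) (linext (dK q1) (Psi q1 (a, ls, b))).
Proof.
move=> szl; rewrite !evl_linext.
rewrite [RHS](eq_evl _ (evl_dK_evK_q1 J)) evl_sum_mull.
under [RHS]eq_bigr => J' _ do rewrite evl_Psi_q1 mulrCA.
rewrite -mulr_sumr (sum_dKcoef_psiev _ szl).
rewrite (evl_barD_q1_nth (fun t => evl (evK J) (Psi q1 t)) _ _ szl) !evl_Psi_q1.
under eq_bigr => i _ do rewrite evl_Psi_q1 scale_sign.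
rewrite scale_sign !mixevD /psiev size_behead szl /= size_takel ?szl //.
have szi (i : 'I_p) m : size (take i ls ++ m :: drop i.+2 ls) = p.
  by rewrite size_cat size_takel /= ?size_drop szl; have := ltn_ord i; lia.
under eq_bigr => i _ do rewrite szi.
case: eqP => szJ; last first.
  by rewrite !mulr0 addr0 add0r big1 // => i _; rewrite !mulr0.
have szE : size (enum J) = p by rewrite -cardE.
rewrite koszulsum_barsum ?sorted_enum_set ?szE //; last exact/allP.
rewrite /barsum szE !mulrDr mulr_sumr; congr (_ + _ + _); try ring.
by apply: eq_bigr => i _; ring.
Qed.

End PsiChain.

(** * The composite, and the return to arbitrary q *)

Section PsiPhi.
Variables (k : fieldType) (N : nat) (R : comAlgType k) (x y : 'I_N -> R).
Implicit Types (a b : mono N) (J : {set 'I_N}) (j : 'I_N).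
Local Notation q1 := (@q1 k N).

Lemma divdiff_ev (i j : 'I_N) : divdiff x y j (ev i) = (i == j)%:R.
Proof.
rewrite /divdiff ffunE eq_sym; case: eqP => [->|_]; last by rewrite big_ord0 mulr0.
rewrite big_ord1 !expr0 mulr1 mulr1 big1 // => u /negPf uj.
by rewrite ffunE uj expr0.
Qed.

(** A nonzero product forces j_{s(t)} = j'_t for every t. Then J' lies in J and has the same size,
    and since the enumeration has no repetition s is trivial. *)
Lemma psiev_evs n (js : n.-tuple 'I_N) J J' (s : 'S_n) : enum J = js ->
  psiev x y J' [seq ev (tnth js (s i)) | i <- enum 'I_n] = ((J' == J) && (s == 1%g))%:R.
Proof.
move=> EJ; rewrite /psiev size_map size_enum_ord.
have szJ : #|J| = n by rewrite cardE EJ size_tuple.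
case: eqP => szJ'; last by case: eqP szJ' => // -> /(_ szJ).
have szE : size (enum J') = n by rewrite -cardE.
pose js' := Tuple (introT eqP szE).
have -> : divprod x y (enum J') [seq ev (tnth js (s i)) | i <- enum 'I_n] =
    \prod_(t < n) (tnth js (s t) == tnth js' t)%:R.
  rewrite /divprod -[enum J']/(tval js') -(map_tnth_enum js') zip_map big_map big_enum.
  by apply: eq_bigr => t _ /=; rewrite divdiff_ev.
case: (boolP [forall t, tnth js (s t) == tnth js' t]) => [/forallP E|]; last first.
  rewrite negb_forall => /existsP[t nt]; rewrite (bigD1 t) //= (negPf nt) mul0r.
  case: eqP => //= EJ'; case: eqP => // s1; case/negP: nt; apply/eqP.
  by rewrite s1 perm1; congr tnth; apply: val_inj; rewrite /= -EJ EJ'.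
rewrite big1 => [|t _]; last by rewrite E.
have JJ' : J' = J.
  apply/eqP; rewrite eqEcard szJ szJ' leqnn andbT; apply/subsetP => j.
  rewrite -mem_enum -[enum J']/(tval js') => /tnthP[t ->].
  by rewrite -(eqP (E t)) -mem_enum EJ mem_tnth.
rewrite JJ' eqxx /=; case: eqP => // ns; case: ns; apply/permP => t; rewrite perm1.
have Ejs : js' = js by apply: val_inj; rewrite /= JJ' EJ.
have u : uniq js by rewrite -EJ enum_uniq.
have j0 := tnth js t; have := eqP (E t); rewrite Ejs !(tnth_nth j0) => /eqP.
by rewrite nth_uniq ?size_tuple // => /eqP/val_inj.
Qed.

Lemma PsiPhi_q1 J' a b J :
  evl (evK x y J') (linext (Psi q1) (Phi q1 (a, J, b))) =
  evl (evK x y J') [:: (1, (a, J, b))].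
Proof.
rewrite evl_linext evl_seq1 scale1r (evl_Phi_q1 _ _ _ (erefl : enum J = in_tuple (enum J))).
under eq_bigr => s _ do rewrite evl_Psi_q1 (psiev_evs _ _ (erefl : enum J = in_tuple (enum J))).
rewrite (bigD1 1%g) //= big1 => [|s /negPf ns]; last by rewrite ns andbF mulr0 scaler0.
by rewrite odd_perm1 expr0 scale1r eqxx andbT addr0 /evK /= eq_sym mulrC.
Qed.

End PsiPhi.

(** * Recovering coefficients from polynomial evaluations *)

Section Separation.
Variables (k : fieldType) (N : nat).
Import mpoly.

Local Notation P := {mpoly k[N + N]}.
Definition leftvar (i : 'I_N) : P := 'X_(lshift N i).
Definition rightvar (i : 'I_N) : P := 'X_(rshift N i).

Definition monopair (a b : mono N) : 'X_{1..N + N} :=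
  [multinom match split i with inl j => a j | inr j => b j end | i < N + N].

Lemma mixev_monopair a b :
  mixev leftvar rightvar 0 a * mixev leftvar rightvar N b = 'X_[monopair a b].
Proof.
rewrite mpolyXE_id big_split_ord /=; congr (_ * _); apply: eq_bigr => i _.
  by rewrite mnmE (unsplitK (inl i)).
by rewrite ltn_ord mnmE (unsplitK (inr i)).
Qed.

Lemma monopair_inj a b a' b' : (monopair a b == monopair a' b') = ((a, b) == (a', b')).
Proof.
apply/eqP/eqP => [E|[-> ->] //]; congr pair; apply/ffunP => i.
  have := congr1 (fun m : 'X_{1..N + N} => m (lshift N i)) E.
  by rewrite !mnmE (unsplitK (inl i)).
have := congr1 (fun m : 'X_{1..N + N} => m (rshift N i)) E.
by rewrite !mnmE (unsplitK (inr i)).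
Qed.

(** In 2N independent variables the monomials x^a y^b are distinct, so evaluating the components
    loses no information. *)
Lemma coef_evK (v : vec k (Kb N)) a b J :
  coef v (a, J, b) = (evl (evK leftvar rightvar J) v)@_(monopair a b).
Proof.
rewrite coef_evl /evl raddf_sum /=; apply: eq_bigr => u _; rewrite mcoeffZ; congr (_ * _).
rewrite /evK mixev_monopair -mulr_natl mulr_natl mulr_natl mcoeffMn mcoeffX monopair_inj.
case: u => c [[a' J'] b'] /=; rewrite !xpair_eqE.
by case: (a' == a); case: (J' == J); case: (b' == b).
Qed.

Lemma veq_evK (v w : vec k (Kb N)) :
  (forall J, evl (evK leftvar rightvar J) v = evl (evK leftvar rightvar J) w) -> veq v w.
Proof. by move=> E [[a J] b]; rewrite !coef_evK E. Qed.

End Separation.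

(** * Return to arbitrary q *)

Section Assembly.
Variables (k : fieldType) (N : nat) (q : 'I_N -> 'I_N -> k).
Hypothesis (hq0 : forall i j, q i j != 0) (hq1 : forall i, q i i = 1).
Hypothesis hqinv : forall i j, q j i = (q i j)^-1.
Implicit Types (a b : mono N) (ls : seq (mono N)) (J : {set 'I_N}).
Local Notation q1 := (@q1 k N).

Lemma size_mem_Phi a b J u : u \in Phi q1 (a, J, b) -> size u.2.1.2 = #|J|.
Proof.
case/mapP => v /mapP[s _ ->] ->.
by rewrite /= size_map size_enum_ord -cardE.
Qed.

Lemma regrade_unit (T : Type) (w : T -> k) t : w t != 0 ->
  [:: (1, t)] = regrade (w t) w [:: (1, t)].
Proof. by move=> w0; rewrite /regrade /= divff // mulr1. Qed.

(** The basis of A itself keeps weight 1: the weight of the source is already the scalar of the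
    product. *)
Lemma epsB_regrade a b : epsB q (a, [::], b) =
  regrade (weightB q (a, [::], b)) (fun=> 1) (epsB q1 (a, [::], b)).
Proof.
rewrite /regrade /epsB /mulA /= /weightB mscal_cons mscal1 tw_q1 totalm_cons.
by rewrite totalm_nil addm0 mul1r divr1 mulr1.
Qed.

Lemma epsK_regrade a b : epsK q (a, set0, b) =
  regrade (weightK q (a, set0, b)) (fun=> 1) (epsK q1 (a, set0, b)).
Proof.
rewrite /regrade /epsK /mulA /= /weightK /= enum_set0 /= mscal_cons mscal1 tw_q1.
by rewrite totalm_cons totalm_nil addm0 mul1r divr1 mulr1.
Qed.

Lemma Phi_lift a b :
  veq (linext (epsB q) (Phi q (a, set0, b))) (linext (epsK q) [:: (1, (a, set0, b))]).
Proof.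
rewrite (regrade_unit (weightK_neq0 hq0 _)) Phi_regrade //.
rewrite (@linext_regrade _ _ _ _ _ (fun=> 1) _ (epsB q1)); last 2 first.
- exact: weightB_neq0.
- move=> [c [[a' ls] b']] /size_mem_Phi /=; rewrite cards0 => /size0nil ->.
  exact: epsB_regrade.
rewrite (@linext_regrade _ _ _ _ _ (fun=> 1) _ (epsK q1)); last 2 first.
- exact: weightK_neq0.
- by move=> u; rewrite inE => /eqP ->; apply: epsK_regrade.
by apply: veq_regrade => t; rewrite !coef_evl Phi_lift_q1.
Qed.

(** Both composites are regradings from the same source weight of their untwisted versions, so the
    untwisted identity suffices. The same scheme serves [Psi_chain] and [PsiPhi]. *)
Lemma Phi_chain p a b J : #|J| = p.+1 ->
  veq (linext (barD q) (Phi q (a, J, b))) (linext (Phi q) (dK q (a, J, b))).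
Proof.
move=> szJ; rewrite Phi_regrade // dK_regrade //.
rewrite (@linext_regrade _ _ _ _ _ (weightB q) _ (barD q1)); last 2 first.
- exact: weightB_neq0.
- by move=> u /size_mem_Phi szu; apply: barD_regrade; rewrite ?szu ?szJ.
rewrite (@linext_regrade _ _ _ _ _ (weightB q) _ (Phi q1)); last 2 first.
- exact: weightK_neq0.
- by move=> u _; apply: Phi_regrade.
by apply: veq_regrade => t; rewrite !coef_evl (Phi_chain_q1 _ _ _ szJ).
Qed.

Lemma Psi_lift a b :
  veq (linext (epsK q) (Psi q (a, [::], b))) (linext (epsB q) [:: (1, (a, [::], b))]).
Proof.
by rewrite /Psi /= !twm0 !tw0m !mulr1 addm0 add0m.
Qed.

Lemma Psi_chain p a b ls : size ls = p.+1 ->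
  veq (linext (Psi q) (barD q (a, ls, b))) (linext (dK q) (Psi q (a, ls, b))).
Proof.
move=> szl; rewrite Psi_regrade // barD_regrade ?szl //.
rewrite (@linext_regrade _ _ _ _ _ (weightK q) _ (Psi q1)); last 2 first.
- exact: weightB_neq0.
- by move=> u _; apply: Psi_regrade.
rewrite (@linext_regrade _ _ _ _ _ (weightK q) _ (dK q1)); last 2 first.
- exact: weightK_neq0.
- by move=> u _; apply: dK_regrade.
by apply: veq_regrade; apply: veq_evK => J; apply: Psi_chain_q1 szl.
Qed.

Lemma PsiPhi a b J : veq (linext (Psi q) (Phi q (a, J, b))) [:: (1, (a, J, b))].
Proof.
rewrite (regrade_unit (weightK_neq0 hq0 _)) Phi_regrade //.
rewrite (@linext_regrade _ _ _ _ _ (weightK q) _ (Psi q1)); last 2 first.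
- exact: weightB_neq0.
- by move=> u _; apply: Psi_regrade.
by apply: veq_regrade; apply: veq_evK => J'; apply: PsiPhi_q1.
Qed.

End Assembly.

Theorem mainTheorem4 (k : fieldType) (N : nat) (q : 'I_N -> 'I_N -> k)
  (hq0 : forall i j, q i j != 0) (hq1 : forall i, q i i = 1)
  (hqinv : forall i j, q j i = (q i j)^-1) :
  [/\
   (* (i) Phi is a chain map K -> B lifting id_A *)
   (forall a b : mono N,
      veq (linext (epsB q) (Phi q (a, set0, b))) (linext (epsK q) [:: (1, (a, set0, b))]))
   /\ (forall (p : nat) (a b : mono N) (J : {set 'I_N}), #|J| = p.+1 ->
      veqB (linext (barD q) (Phi q (a, J, b))) (linext (Phi q) (dK q (a, J, b)))),
   (* (ii) Psi is a chain map B -> K lifting id_A *)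
   (forall a b : mono N,
      veq (linext (epsK q) (Psi q (a, [::], b))) (linext (epsB q) [:: (1, (a, [::], b))]))
   /\ (forall (p : nat) (a b : mono N) (ls : seq (mono N)),
      size ls = p.+1 -> all (fun m => m != mono0 N) ls ->
      veq (linext (Psi q) (barD q (a, ls, b))) (linext (dK q) (Psi q (a, ls, b))))
  & (* (iii) Psi o Phi = id_K *)
   forall (a b : mono N) (J : {set 'I_N}),
      veq (linext (Psi q) (Phi q (a, J, b))) [:: (1, (a, J, b))] ].
Proof.
split; first split.
- exact: Phi_lift.
- by move=> p a b J szJ t _; apply: (Phi_chain hq0 hq1 hqinv _ _ szJ).
- split; first exact: Psi_lift.
  by move=> p a b ls szl _; apply: (Psi_chain hq0 hq1 hqinv _ _ szl).
- exact: PsiPhi.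
Qed.
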